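(* Let $X$ be a pointed smooth manifold and let $A=\sum_{k=1}^N A_k\otimes h_k$, $A_k\in\Omega^1_{DR}(X)$, be an arbitrary $\mathfrak g$-valued $1$-form on $X$ (the global gauge potential of a connection on the trivial principal $G$-bundle over $X$). Then the map $$\widetilde M_A(f)=\sum_{n\ge 0}\ \sum_{k_1,\dots,k_n=1}^N \bigl(X_{k_1}\cdots X_{k_n}(f)\bigr)(e)\,[A_{k_1}|\dots|A_{k_n}],\qquad f\in\mathcal A(G),$$ from $\mathcal A(G)$ to the (completed) bar-resolution $B(\Omega_{DR}(X))$ is a homomorphism of bialgebras.
   Context: $G$ is a compact connected semisimple algebraic Lie group embedded in a unitary group $U(m)$ (or orthogonal group $O(m)$), $e\in G$ is the unit, $\mathfrak g$ its Lie algebra, $N=\dim\mathfrak g$, $h_1,\dots,h_N$ a basis of $\mathfrak g$ orthonormal for the Killing form, and $X_k$ the left-invariant vector field on $G$ corresponding to $h_k$, $(X_kf)(g)=\frac{d}{dt}|_{t=0}f(g\exp(th_k))$. $\mathcal A(G)$ is the Hopf algebra of (polynomial) regular functions on $G$, generated by the matrix coordinates $u_{ij}$ (and $\bar u_{ij}$ in the unitary case), with pointwise multiplication, coproduct $\Delta f(g,h)=f(gh)$ (so $\Delta(u_{ij})=\sum_k u_{ik}\otimes u_{kj}$) and counit $\epsilon(f)=f(e)$. $B(\Omega_{DR}(X))$ is the space of (possibly infinite) sums over $n\ge0$ of elements of $(\Omega_{DR}(X)[1])^{\otimes n}$, whose elements are written $[w_1|\dots|w_n]$; a form $w$ has degree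 $|w|-1$ as an element of $\Omega_{DR}(X)[1]$, so $1$-forms have degree $0$. The multiplication on it is the (graded) shuffle product with unit the empty tensor $1=[\,]$, the coproduct is deconcatenation $\nabla[a_1|\dots|a_n]=\sum_{i=0}^n[a_1|\dots|a_i]\otimes[a_{i+1}|\dots|a_n]$ (with values in the completed tensor product), and the counit is the projection onto the $n=0$ summand. ''Homomorphism of bialgebras'' refers to these multiplications, units, comultiplications and counits; differentials are not involved. *)

(* Defs.v *)
From HB Require Import structures.
From mathcomp Require Import all_boot all_order all_algebra.
From mathcomp Require Import generic_quotient ring_quotient complex freeg.
From mathcomp Require Import boolp classical_sets functions reals.
From mathcomp Require Import topology normedtype sequences.

Set Implicit Arguments.
Unset Strict Implicit.
Unset Printing Implicit Defensive.

Import Order.TTheory GRing.Theory Num.Theory.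
Import numFieldNormedType.Exports.

Local Open Scope classical_set_scope.
Local Open Scope ring_scope.
Local Open Scope quotient_scope.

Section Presented.
Variables (K : fieldType) (S : choiceType) (rel : set {freeg S / K}).

Definition relspan : {pred {freeg S / K}} := fun x =>
  `[< forall P : set {freeg S / K}, P 0 ->
        (forall c y z, P y -> P z -> P (c *: y + z)) -> rel `<=` P -> P x >].

Lemma relspanP x : reflect (forall P : set {freeg S / K}, P 0 ->
  (forall c y z, P y -> P z -> P (c *: y + z)) -> rel `<=` P -> P x)
  (x \in relspan).
Proof. exact: asboolP. Qed.

Lemma relspan_closed : subsemimod_closed relspan.
Proof.
split; first split; first by apply/relspanP => P P0 _ _; exact: P0.
- move=> x y; move=> /relspanP xP /relspanP yP; apply/relspanP => P P0 PD Prel.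
  by rewrite -[x]scale1r; exact: PD (xP P P0 PD Prel) (yP P P0 PD Prel).
- move=> c x /relspanP xP; apply/relspanP => P P0 PD Prel.
  by rewrite -[_ *: _]addr0; exact: PD (xP P P0 PD Prel) P0.
Qed.

HB.instance Definition _ :=
  GRing.isSubmodClosed.Build K {freeg S / K} relspan relspan_closed.

Definition presented : Type := Quotient.quot relspan.
HB.instance Definition _ := GRing.Zmodule.on presented.
HB.instance Definition _ := EqQuotient.on presented.

Definition pscale (c : K) (x : presented) : presented :=
  \pi_presented (c *: repr x).

Lemma pi_scale c (x : {freeg S / K}) :
  pscale c (\pi_presented x) = \pi_presented (c *: x) :> presented.
Proof.
apply/eqP; rewrite -[_ == _]Quotient.idealrBE -scalerBr; apply: rpredZ.
by rewrite Quotient.idealrBE reprK.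
Qed.

Lemma pi_add (x y : {freeg S / K}) :
  \pi_presented (x + y) = \pi_presented x + \pi_presented y :> presented.
Proof. exact: (Quotient.pi_add relspan). Qed.

Fact pscalerA a b x : pscale a (pscale b x) = pscale (a * b) x.
Proof. by elim/quotW: x => x; rewrite (pi_scale b) !pi_scale scalerA. Qed.
Fact pscale1r : left_id 1 pscale.
Proof. by elim/quotW => x; rewrite pi_scale scale1r. Qed.
Fact pscalerDr : right_distributive pscale +%R.
Proof.
move=> c; elim/quotW => x; elim/quotW => y.
by rewrite -pi_add !pi_scale -pi_add scalerDr.
Qed.
Fact pscalerDl v : {morph pscale^~ v : a b / a + b}.
Proof.
by move=> a b; elim/quotW: v => v; rewrite !pi_scale -pi_add scalerDl.
Qed.

HB.instance Definition _ := GRing.Zmodule_isLmodule.Build K presented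
  pscalerA pscale1r pscalerDr pscalerDl.

Definition gen (s : S) : presented := \pi_presented << s >>.

Lemma gen_lin c s t u :
  rel (<< s >> - c *: << t >> - << u >>) -> gen s = c *: gen t + gen u.
Proof.
move=> stu; rewrite /gen [c *: _]pi_scale -pi_add.
apply/eqP; rewrite -[_ == _]Quotient.idealrBE opprD addrA.
by apply/relspanP => P _ _; exact.
Qed.

(* The linear map induced by a function on generators.  It is computed on a
   chosen representative, so it is meaningful when the function respects the
   relations, see [lin_extP] and [lin_ext_gen]; for the maps below this is the
   content of [deconc_tword], [shuffle_tword] and [tens_eval_tens]. *)
Definition lin_ext (M : lmodType K) (phi : S -> M) (x : presented) : M :=
  fglift phi (repr x).

Section LinExt.
Variables (M : lmodType K) (phi : S -> M).
Hypothesis phi_rel : forall z, rel z -> fglift phi z = 0.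

HB.instance Definition _ := GRing.isAdditive.Build {freeg S / K} M
  (fglift phi) (lift_is_additive phi).

Lemma fglift_scale c (x : {freeg S / K}) :
  fglift phi (c *: x) = c *: fglift phi x.
Proof.
rewrite -(freeg_sumE x) scaler_sumr.
rewrite (raddf_sum (fglift phi)) (raddf_sum (fglift phi)) scaler_sumr /=.
apply: eq_bigr => y _; rewrite [in RHS]liftU scalerA.
have -> : c *: << coeff y x *g y >> = << (c * coeff y x) *g y >> :> {freeg S / K}.
  by apply/eqP/freeg_eqP => z; rewrite coeffZ !coeffU mulrA.
exact: liftU.
Qed.

Lemma fglift_relspan z : z \in relspan -> fglift phi z = 0.
Proof.
move=> /relspanP zP; apply: (zP [set w | fglift phi w = 0]) => /=.
- exact: raddf0.
- by move=> c y w y0 w0; rewrite raddfD /= fglift_scale y0 w0 scaler0 addr0.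
- exact: phi_rel.
Qed.

Lemma lin_ext_pi z : lin_ext phi (\pi_presented z) = fglift phi z.
Proof.
apply/eqP; rewrite -subr_eq0 -raddfB /=; apply/eqP/fglift_relspan.
by rewrite Quotient.idealrBE reprK.
Qed.

Lemma lin_ext_gen s : lin_ext phi (gen s) = phi s.
Proof. by rewrite lin_ext_pi liftU scale1r. Qed.

Lemma lin_extP c x y : lin_ext phi (c *: x + y) = c *: lin_ext phi x + lin_ext phi y.
Proof.
elim/quotW: x => x; elim/quotW: y => y.
rewrite [c *: _]pi_scale -pi_add !lin_ext_pi.
by rewrite raddfD /= fglift_scale.
Qed.

End LinExt.
End Presented.

Section Tensor.
Variables (K : fieldType) (U V : lmodType K).

Definition bilin_rel : set {freeg (U * V)%type / K} := [set z |
  (exists c x y v, z = << (c *: x + y, v) >> - c *: << (x, v) >> - << (y, v) >>)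
  \/
  (exists u c x y, z = << (u, c *: x + y) >> - c *: << (u, x) >> - << (u, y) >>)].

Definition tensor := presented bilin_rel.
HB.instance Definition _ := GRing.Lmodule.on tensor.
Definition tens (u : U) (v : V) : tensor := gen bilin_rel (u, v).

Lemma tensDl c x y v : tens (c *: x + y) v = c *: tens x v + tens y v.
Proof. by apply: gen_lin; left; exists c, x, y, v. Qed.

Lemma tensDr u c x y : tens u (c *: x + y) = c *: tens u x + tens u y.
Proof. by apply: gen_lin; right; exists u, c, x, y. Qed.

End Tensor.

Section Bar.
Variables (K : fieldType) (Om : nat -> lmodType K).

Definition letter := {p : nat & Om p}.
Definition mkletter p (w : Om p) : letter := existT _ p w.

(* degree in the shifted space [Om[1]] *)
Definition bdeg (a : letter) : int := (tag a)%:Z - 1.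

(* [Om[1]^{\otimes n}] is the direct sum over [(p_1, ..., p_n)] of the spaces
   [Om p_1 \otimes ... \otimes Om p_n]: it is generated by the words
   [[w_1| ... |w_n]] in homogeneous elements, subject to linearity in each
   letter. *)
Definition multilin_rel n : set {freeg (n.-tuple letter) / K} := [set z |
  exists (l r : seq letter) (p : nat) (c : K) (x y : Om p)
         (s t u : n.-tuple letter),
    [/\ s = l ++ mkletter (c *: x + y) :: r :> seq letter,
        t = l ++ mkletter x :: r :> seq letter,
        u = l ++ mkletter y :: r :> seq letter &
        z = << s >> - c *: << t >> - << u >>]].

Definition tpow n := presented (@multilin_rel n).
HB.instance Definition _ n := GRing.Lmodule.on (tpow n).

Definition tword n (w : n.-tuple letter) : tpow n := gen (@multilin_rel n) w.

(* [word n w] is [[w]] if [w] has length [n] and [0] otherwise *)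
Definition word n (w : seq letter) : tpow n :=
  if insub w is Some t then tword t else 0.

(* Koszul sign for moving [b] past the word [u] *)
Definition koszul (b : letter) (u : seq letter) : K :=
  \prod_(a <- u) (-1) ^ (bdeg a * bdeg b).

(* all shuffles of [u] and [v], with their signs: the first letter of a shuffle
   comes either from [u] or, after moving past the whole of [u], from [v] *)
Fixpoint shuffles (u : seq letter) : seq letter -> seq (K * seq letter) :=
  if u is a :: u' then
    fix shuffles_u v := if v is b :: v' then
        [seq (cw.1, a :: cw.2) | cw <- shuffles u' v] ++
        [seq (koszul b u * cw.1, b :: cw.2) | cw <- shuffles_u v']
      else [:: (1, u)]
  else fun v => [:: (1, v)].

Definition shuffle n p q (x : tpow p) (y : tpow q) : tpow n :=
  lin_ext (fun u : p.-tuple letter =>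
    lin_ext (fun v : q.-tuple letter =>
      \sum_(cw <- shuffles u v) cw.1 *: word n cw.2) y) x.

(* families, i.e. possibly infinite sums, of elements of [Om[1]^{\otimes n}] *)
Definition bar := forall n, tpow n.

Definition bar_one : bar := fun n => word n [::].

Definition bar_mul (x y : bar) : bar := fun n =>
  \sum_(i < n.+1) shuffle n (x i) (y (n - i)%N).

Definition bar_counit (x : bar) : K :=
  lin_ext (fun _ : 0.-tuple letter => 1 : K^o) (x 0%N).

(* completed tensor product of [bar] with itself: families over [(p, q)] *)
Definition bar2 := forall p q, tensor (tpow p) (tpow q).

Definition deconc (x : bar) : bar2 := fun p q =>
  lin_ext (fun w : (p + q).-tuple letter =>
    tens (word p (take p w)) (word q (drop p w))) (x (p + q)%N).

(* [M \otimes M] followed by the inclusion of [bar \otimes bar] in [bar2] *)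
Definition bar_tens2 (A : lmodType K) (M : A -> bar) (t : tensor A A) : bar2 :=
  fun p q => lin_ext (fun fg : A * A => tens (M fg.1 p) (M fg.2 q)) t.

End Bar.

Section BarWellDefined.
Variables (K : fieldType) (Om : nat -> lmodType K).
Local Notation letter := (letter Om).
Implicit Types (u v w l r : seq letter).

Lemma word_lin n l r p c (x y : Om p) :
  word n (l ++ mkletter (c *: x + y) :: r)
  = c *: word n (l ++ mkletter x :: r) + word n (l ++ mkletter y :: r).
Proof.
have [Nn|nN] := eqVneq (size l + (size r).+1)%N n; last first.
  by rewrite /word !insubF ?size_cat /= ?(negbTE nN) // scaler0 addr0.
have ok (z : Om p) : size (l ++ mkletter z :: r) == n by rewrite size_cat Nn.
rewrite /word !insubT ?ok // => Hy Hx Hs; apply: gen_lin.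
by exists l, r, p, c, x, y, (Tuple Hs), (Tuple Hx), (Tuple Hy).
Qed.

Lemma word_tword n (t : n.-tuple letter) : word n t = tword t.
Proof. by rewrite /word valK. Qed.

Lemma lin_ext_tword n (M : lmodType K) (phi : seq letter -> M) :
    (forall l r p c (x y : Om p),
      phi (l ++ mkletter (c *: x + y) :: r)
      = c *: phi (l ++ mkletter x :: r) + phi (l ++ mkletter y :: r)) ->
  forall z, @multilin_rel K Om n z ->
    fglift (fun w : n.-tuple letter => phi w) z = 0.
Proof.
move=> phiL _ [l [r [p [c [x [y [s [t [u [sE tE uE ->]]]]]]]]]].
rewrite raddfB raddfB /= fglift_scale !liftU !scale1r sE tE uE phiL.
by rewrite addrAC addrK subrr.
Qed.

Lemma cut_lin p q l r d c (x y : Om d) :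
  let phi w := tens (word p (take p w)) (word q (drop p w)) in
  phi (l ++ mkletter (c *: x + y) :: r)
  = c *: phi (l ++ mkletter x :: r) + phi (l ++ mkletter y :: r).
Proof.
rewrite /= !take_cat !drop_cat; case: ltnP => pl; first by rewrite word_lin tensDr.
case: (p - size l)%N => [|k] /=; first by rewrite (word_lin q [::]) tensDr.
by rewrite word_lin tensDl.
Qed.

Lemma deconc_tword p q (x : bar Om) (t : (p + q).-tuple letter) :
  x (p + q)%N = tword t ->
  deconc x p q = tens (word p (take p t)) (word q (drop p t)).
Proof.
move=> xt; rewrite /deconc xt lin_ext_gen //.
apply: (lin_ext_tword (phi := fun w =>
  tens (word p (take p w)) (word q (drop p w)))) => *.
exact: cut_lin.
Qed.

Let Sh n w u v := \sum_(cw <- shuffles u v) cw.1 *: word n (w ++ cw.2).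

Let Sh_cons n w a u b v : Sh n w (a :: u) (b :: v) =
  Sh n (rcons w a) u (b :: v)
  + koszul b (a :: u) *: Sh n (rcons w b) (a :: u) v.
Proof.
rewrite /Sh /= big_cat !big_map scaler_sumr /=; congr (_ + _).
  by apply: eq_bigr => cw _; rewrite cat_rcons.
by apply: eq_bigr => cw _; rewrite cat_rcons scalerA.
Qed.

Let Sh_nill n w v : Sh n w [::] v = word n (w ++ v).
Proof. by rewrite /Sh /= big_seq1 scale1r. Qed.

Let Sh_nilr n w u : Sh n w u [::] = word n (w ++ u).
Proof. by rewrite /Sh; case: u => [|a u] /=; rewrite big_seq1 scale1r. Qed.

Let Sh_linw n w1 w2 u v p c (x y : Om p) :
  Sh n (w1 ++ mkletter (c *: x + y) :: w2) u v
  = c *: Sh n (w1 ++ mkletter x :: w2) u v + Sh n (w1 ++ mkletter y :: w2) u v.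
Proof.
rewrite /Sh scaler_sumr -big_split; apply: eq_bigr => cw _ /=.
rewrite -!catA !cat_cons word_lin.
by rewrite scalerDr !scalerA mulrC.
Qed.

Let koszul_eql b l r p (x y : Om p) :
  koszul b (l ++ mkletter x :: r) = koszul b (l ++ mkletter y :: r).
Proof. by rewrite /koszul !big_cat !big_cons. Qed.

Let comb3 (V : lmodType K) (c k : K) (a b a' b' : V) :
  c *: a + b + k *: (c *: a' + b') = c *: (a + k *: a') + (b + k *: b').
Proof. by rewrite !scalerDr !scalerA mulrC addrACA. Qed.

Let Sh_linl n w l r v p c (x y : Om p) :
  Sh n w (l ++ mkletter (c *: x + y) :: r) v
  = c *: Sh n w (l ++ mkletter x :: r) v + Sh n w (l ++ mkletter y :: r) v.
Proof.
elim: l v w => [|a l IHl]; elim=> [|b v IHv] w.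
- by rewrite !Sh_nilr /= word_lin.
- rewrite /= !Sh_cons -!cats1 Sh_linw !cats1 [in LHS]IHv.
  by rewrite (koszul_eql b [::] r (c *: x + y) y)
    (koszul_eql b [::] r x y) comb3.
- by rewrite !Sh_nilr !catA word_lin.
- rewrite /= !Sh_cons IHl -!cat_cons IHv.
  by rewrite (koszul_eql b (a :: l) r (c *: x + y) y)
    (koszul_eql b (a :: l) r x y) comb3.
Qed.

Let Sh_linr n w l r u p c (x y : Om p) :
  Sh n w u (l ++ mkletter (c *: x + y) :: r)
  = c *: Sh n w u (l ++ mkletter x :: r) + Sh n w u (l ++ mkletter y :: r).
Proof.
elim: l u w => [|b l IHl]; elim=> [|a u IHu] w.
- by rewrite !Sh_nill ?catA word_lin.
- rewrite /= !Sh_cons -!cats1 IHu !cats1 -[rcons w (mkletter (_ + _))]cats1.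
  by rewrite Sh_linw !cats1 comb3.
- by rewrite !Sh_nill ?catA word_lin.
- by rewrite /= !Sh_cons IHl -!cat_cons IHu comb3.
Qed.

Lemma shuffle_tword n p q (u : p.-tuple letter) (v : q.-tuple letter) :
  shuffle n (tword u) (tword v)
  = \sum_(cw <- shuffles u v) cw.1 *: word n cw.2.
Proof.
have inner u' : lin_ext (fun v : q.-tuple letter => Sh n [::] u' v) (tword v)
    = Sh n [::] u' v.
  rewrite lin_ext_gen //; apply: (lin_ext_tword (phi := Sh n [::] u')) => *.
  exact: (Sh_linr n [::]).
rewrite /shuffle lin_ext_gen /=; first exact: inner.
apply: (lin_ext_tword (phi := fun u' => lin_ext (fun v : q.-tuple letter =>
  Sh n [::] u' v) (tword v))) => *.
by rewrite !inner Sh_linl.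
Qed.

End BarWellDefined.

(* The ground field of all the vector spaces involved: complex functions and
   forms go with subgroups of [U(m)], real ones with subgroups of [O(m)]. *)
Inductive ground := Reals | Complexes.

Definition scalar (R : realType) (s : ground) : numFieldType :=
  match s with Reals => R | Complexes => R[i] end.

Definition ofreal (R : realType) (s : ground) : R -> scalar R s :=
  match s with Reals => id | Complexes => real_complex R end.

Definition conjs (R : realType) (s : ground) : scalar R s -> scalar R s :=
  match s with Reals => id | Complexes => @conjc R end.

Section RealDerivative.
Variables (R : realType) (s : ground).
Local Notation K := (scalar R s).

Definition dquot (phi : R -> K) (t : R) : K :=
  (ofreal s t)^-1 * (phi t - phi 0).

Definition deriv0 (phi : R -> K) : K := lim (dquot phi t @[t --> (0 : R)^']).

(* [f] is of class [C^k] on the open set [U]: [g] stands for the [i]-th partial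
   derivative, whose values outside of [U] are irrelevant *)
Fixpoint Ck (k : nat) n (U : set 'rV[R]_n) (f : 'rV[R]_n -> K) : Prop :=
  {in U, continuous f} /\
  if k is k'.+1 then forall i : 'I_n, exists2 g : 'rV[R]_n -> K,
    (forall x, U x ->
       dquot (fun t => f (x + t *: delta_mx 0 i)) t @[t --> (0 : R)^'] --> g x)
    & Ck k' U g
  else True.

Definition smooth_on n (U : set 'rV[R]_n) f := forall k, Ck k U f.

End RealDerivative.

Record chart (R : realType) (n : nat) (X : topologicalType) := Chart {
  cdom : set X;
  cmap : X -> 'rV[R]_n;
  cinv : 'rV[R]_n -> X;
  cdom_open : open cdom;
  cimg_open : open (cmap @` cdom);
  cmapK : {in cdom, cancel cmap cinv};
  cmap_continuous : {in cdom, continuous cmap};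
  cinv_continuous : {in cmap @` cdom, continuous cinv}
}.

(* the base point is [point] *)
Record manifold (R : realType) (n : nat) := Manifold {
  pts :> ptopologicalType;
  pts_hausdorff : hausdorff_space pts;
  pts_second_countable : @second_countable pts;
  atlas : set (chart R n pts);
  atlas_cover : forall x : pts, exists2 c, atlas c & cdom c x;
  atlas_smooth : forall c d, atlas c -> atlas d -> forall j : 'I_n,
    smooth_on (s := Reals) (cmap c @` (cdom c `&` cdom d))
      (fun y => cmap d (cinv c y) 0 j)
}.

Section SmoothClosure.
Variables (R : realType) (s : ground) (n : nat) (U : set 'rV[R]_n).
Local Notation K := (scalar R s).
Implicit Types f g : 'rV[R]_n -> K.

Lemma Ck_cst k (c : K) : Ck k U (fun=> c).
Proof.
have cstC (c' : K) : {in U, continuous (fun=> c' : K)} by move=> x _; exact: cst_continuous.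
elim: k c => [|k IHk] c; split=> // i.
exists (fun=> 0) => [x _|]; last exact: IHk.
rewrite (_ : dquot _ = fun=> 0); first exact: cvg_cst.
by apply/funext => t; rewrite /dquot subrr mulr0.
Qed.

Lemma Ck_lin k c f g : Ck k U f -> Ck k U g -> Ck k U (fun x => c * f x + g x).
Proof.
have cvgL (T : Type) (F : set_system T) (FF : Filter F) (u v : T -> K) (a b : K) :
    u @ F --> a -> v @ F --> b -> (fun t => c * u t + v t) @ F --> c * a + b.
  by move=> ua vb; apply: cvgD => //; apply: cvgM => //; exact: cvg_cst.
elim: k f g => [|k IHk] f g [fc fS] [gc gS]; (split; first by
  move=> x xU; exact: (cvgL _ _ (nbhs_filter x)) (fc x xU) (gc x xU)) => // i.
have [f' ff' f'k] := fS i; have [g' gg' g'k] := gS i.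
exists (fun x => c * f' x + g' x) => [x xU|]; last exact: IHk.
rewrite [dquot _](_ : _ = fun t => c * dquot (fun t => f (x + t *: delta_mx 0 i)) t
                        + dquot (fun t => g (x + t *: delta_mx 0 i)) t).
  exact: cvgL (ff' x xU) (gg' x xU).
apply/funext => t; rewrite /dquot mulrCA -mulrDr; congr (_ * _).
by rewrite mulrBr opprD addrACA.
Qed.

Lemma CkW k f : Ck k.+1 U f -> Ck k U f.
Proof.
elim: k f => [|k IHk] f [fc fS]; split=> // i.
by have [f' ff' f'k] := fS i; exists f' => //; exact: IHk.
Qed.

Lemma cvg_line f i x : {for x, continuous f} ->
  f (x + t *: delta_mx 0 i) @[t --> (0 : R)^'] --> f x.
Proof.
move=> fx; apply: (@cvg_within_filter _ _ _ (nbhs (0 : R))).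
apply: (@cvg_comp _ _ _ (fun t : R => x + t *: delta_mx 0 i) f _ (nbhs x)) => //.
have -> : nbhs x = nbhs (x + 0 *: delta_mx 0 i) by rewrite scale0r addr0.
by apply: cvgD; [exact: cvg_cst | apply: cvgZr_tmp; exact: cvg_id].
Qed.

Lemma Ck_mul k f g : Ck k U f -> Ck k U g -> Ck k U (fun x => f x * g x).
Proof.
elim: k f g => [|k IHk] f g fk gk.
  have [fc _] := fk; have [gc _] := gk; split=> // x xU.
  exact: (@cvgM _ _ _ (nbhs_filter x)) (fc x xU) (gc x xU).
have [fk' gk'] := (CkW fk, CkW gk).
have [fc fS] := fk; have [gc gS] := gk.
split=> [x xU|i]; first exact: (@cvgM _ _ _ (nbhs_filter x)) (fc x xU) (gc x xU).
have [f' ff' f'k] := fS i; have [g' gg' g'k] := gS i.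
exists (fun x => f' x * g x + f x * g' x) => [x xU|].
  rewrite [dquot _](_ : _ = fun t =>
    dquot (fun t => f (x + t *: delta_mx 0 i)) t * g (x + t *: delta_mx 0 i)
    + f x * dquot (fun t => g (x + t *: delta_mx 0 i)) t).
    apply: cvgD; apply: cvgM; [exact: ff'| |exact: cvg_cst|exact: gg'].
    by apply: cvg_line; apply: gc; rewrite inE.
  apply/funext => t; rewrite /dquot !scale0r !addr0 -!mulrA [f x * (_ * _)]mulrCA -mulrDr.
  by congr (_ * _); rewrite mulrBl mulrBr addrA subrK.
have := Ck_lin 1 (IHk _ _ f'k gk') (IHk _ _ fk' g'k).
by congr Ck; apply/funext => x; rewrite mul1r.
Qed.

End SmoothClosure.

Section SmoothFunctions.
Variables (R : realType) (s : ground) (n : nat) (X : manifold R n).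
Local Notation K := (scalar R s).

Definition smooth : {pred X -> K^o} := fun f =>
  `[< forall c, atlas c -> smooth_on (cmap c @` cdom c) (f \o cinv c : _ -> K) >].

Lemma smoothP f : reflect
  (forall c, atlas c -> smooth_on (cmap c @` cdom c) (f \o cinv c : _ -> K))
  (f \in smooth).
Proof. exact: asboolP. Qed.

Lemma smooth_submod : subsemimod_closed smooth.
Proof.
split; first split.
- by apply/smoothP => c _ k; exact: Ck_cst.
- move=> f g /smoothP fs /smoothP gs; apply/smoothP => c ca k.
  have := Ck_lin 1 (fs c ca k) (gs c ca k).
  by congr Ck; apply/funext => x; rewrite mul1r.
- move=> a f /smoothP fs; apply/smoothP => c ca k.
  have := Ck_lin a (fs c ca k) (Ck_cst _ k 0).
  by congr Ck; apply/funext => x; rewrite addr0.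
Qed.

Lemma smooth_mul : mulr_closed smooth.
Proof.
split; first by apply/smoothP => c _ k; exact: Ck_cst.
move=> f g /smoothP fs /smoothP gs; apply/smoothP => c ca k.
exact: Ck_mul (fs c ca k) (gs c ca k).
Qed.

HB.instance Definition _ :=
  GRing.isSubmodClosed.Build K (X -> K^o) smooth smooth_submod.
HB.instance Definition _ := GRing.isMulClosed.Build (X -> K^o) smooth smooth_mul.

Record smoothfun := Smoothfun { sfun :> X -> K^o; sfunP : sfun \in smooth }.
HB.instance Definition _ := [isSub for sfun].
HB.instance Definition _ := [Choice of smoothfun by <:].
HB.instance Definition _ := [SubChoice_isSubLmodule of smoothfun by <:].
HB.instance Definition _ :=
  GRing.SubZmodule_isSubPzRing.Build _ _ smoothfun (GRing.subringClosedP _).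
HB.instance Definition _ :=
  GRing.SubPzRing_isSubComPzRing.Build _ _ smoothfun.

End SmoothFunctions.

Section DifferentialForms.
Variables (R : realType) (n : nat) (X : manifold R n).
Local Notation Cinf := (smoothfun Reals X).

(* vector fields, as derivations of the algebra of real smooth functions *)
Record vfield := Vfield {
  vder :> Cinf -> Cinf;
  vder_linear : forall (c : scalar R Reals) (f g : Cinf),
    vder (c *: f + g) = c *: vder f + vder g;
  vder_leibniz : forall f g : Cinf, vder (f * g) = vder f * g + f * vder g
}.

Fact vcomb_linear (f : Cinf) (D D' : vfield) (c : scalar R Reals) (g h : Cinf) :
  f * D (c *: g + h) + D' (c *: g + h)
  = c *: (f * D g + D' g) + (f * D h + D' h).
Proof.
rewrite !vder_linear mulrDr scalerDr addrACA; congr (_ + _ + _).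
by apply/val_inj/funext => x /=; exact: mulrCA.
Qed.

Fact vcomb_leibniz (f : Cinf) (D D' : vfield) (g h : Cinf) :
  f * D (g * h) + D' (g * h) = (f * D g + D' g) * h + g * (f * D h + D' h).
Proof.
rewrite !vder_leibniz !mulrDr mulrDl addrACA !mulrA.
by rewrite [g * f]mulrC.
Qed.

(* the vector field [f D + D'] *)
Definition vcomb (f : Cinf) (D D' : vfield) : vfield :=
  Vfield (vcomb_linear f D D') (vcomb_leibniz f D D').

Variable s : ground.
Local Notation K := (scalar R s).

(* scalar-valued forms of degree [p]: alternating maps on vector fields that
   are multilinear over the smooth functions *)
Definition is_form p : {pred ('I_p -> vfield) -> smoothfun s X} := fun w =>
  `[< (forall (v : 'I_p -> vfield) i (f : Cinf) (D D' : vfield) x,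
         w [eta v with i |-> vcomb f D D'] x
         = ofreal s (f x) * w [eta v with i |-> D] x
           + w [eta v with i |-> D'] x) /\
      (forall (v : 'I_p -> vfield) i j, i != j -> v i = v j -> w v = 0) >].

Lemma is_formP p (w : ('I_p -> vfield) -> smoothfun s X) : reflect
  ((forall (v : 'I_p -> vfield) i (f : Cinf) (D D' : vfield) x,
      w [eta v with i |-> vcomb f D D'] x
      = ofreal s (f x) * w [eta v with i |-> D] x
        + w [eta v with i |-> D'] x) /\
   (forall (v : 'I_p -> vfield) i j, i != j -> v i = v j -> w v = 0))
  (w \in @is_form p).
Proof. exact: asboolP. Qed.

Lemma is_form_submod p : subsemimod_closed (@is_form p).
Proof.
split; first split.
- by apply/is_formP; split=> // *; rewrite /= mulr0 addr0.
- move=> w w' /is_formP[wL wA] /is_formP[wL' wA']; apply/is_formP; split.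
    move=> v i f D D' x; have := (wL v i f D D' x, wL' v i f D D' x).
    by rewrite /= => -[] e e'; rewrite [LHS](congr2 +%R e e') mulrDr addrACA.
  move=> v i j ij vij.
  by rewrite [LHS](congr2 +%R (wA v i j ij vij) (wA' v i j ij vij)) addr0.
- move=> a w /is_formP[wL wA]; apply/is_formP; split.
    move=> v i f D D' x; have /= e := wL v i f D D' x.
    by rewrite [LHS](congr1 ( *%R a) e) mulrDr mulrCA.
  move=> v i j ij vij.
  by rewrite [LHS](congr1 ( *:%R a) (wA v i j ij vij)) scaler0.
Qed.

HB.instance Definition _ p := GRing.isSubmodClosed.Build K
  (('I_p -> vfield) -> smoothfun s X) (@is_form p) (@is_form_submod p).

Record diffform p := Diffform {
  dform :> ('I_p -> vfield) -> smoothfun s X;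
  dformP : dform \in @is_form p
}.
HB.instance Definition _ p := [isSub for @dform p].
HB.instance Definition _ p := [Choice of diffform p by <:].
HB.instance Definition _ p := [SubChoice_isSubLmodule of diffform p by <:].

End DifferentialForms.

Record matgroup (R : realType) (s : ground) (m : nat) := Matgroup {
  gset :> set 'M[scalar R s]_m;
  gset1 : gset 1%:M;
  gsetM : forall x y, gset x -> gset y -> gset (x *m y);
  gsetV : forall x, gset x -> gset (invmx x)
}.

Section MatrixGroups.
Variables (R : realType) (s : ground) (m : nat).
Local Notation K := (scalar R s).
Implicit Types (G : matgroup R s m).

(* polynomials with coefficients in [K] in the functions [u_ij] and their
   conjugates *)
Inductive polyfun (T : Type) (u : T -> 'M[K]_m) : (T -> K) -> Prop :=
| polyfun_cst c : polyfun u (fun=> c)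
| polyfun_coord i j : polyfun u (fun g => u g i j)
| polyfun_conj i j : polyfun u (fun g => conjs (u g i j))
| polyfun_add f1 f2 :
    polyfun u f1 -> polyfun u f2 -> polyfun u (fun g => f1 g + f2 g)
| polyfun_mul f1 f2 :
    polyfun u f1 -> polyfun u f2 -> polyfun u (fun g => f1 g * f2 g).

(* for real scalars [conjs] is the identity and this says [G <= O(m)] *)
Definition unitary G := forall x, gset G x ->
  x *m (map_mx (@conjs R s) x)^T = 1%:M.

Definition algebraic G := exists2 P : set ('M[K]_m -> K),
  P `<=` polyfun id & gset G = [set x | forall p, P p -> p x = 0].

Definition expm (x : 'M[K]_m) : 'M[K]_m :=
  limn (series (fun k => (k`!%:R)^-1 *: x ^+ k)).

Definition lie G : set 'M[K]_m :=
  [set x | forall t : R, gset G (expm (ofreal s t *: x))].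

Definition bracket (x y : 'M[K]_m) := x *m y - y *m x.

Definition real_subspace (V : set 'M[K]_m) :=
  V 0 /\ forall (t : R) x y, V x -> V y -> V (ofreal s t *: x + y).

Definition lie_ideal G (I : set 'M[K]_m) :=
  [/\ real_subspace I, I `<=` lie G &
      forall x y, lie G x -> I y -> I (bracket x y)].

Definition derived (I : set 'M[K]_m) : set 'M[K]_m := [set z | forall V,
  real_subspace V -> (forall x y, I x -> I y -> V (bracket x y)) -> V z].

(* the Lie algebra has no nonzero solvable ideal *)
Definition semisimple G := forall I, lie_ideal G I ->
  (exists k, iter k derived I `<=` [set 0]) -> I `<=` [set 0].

Definition lcomb N (h : 'I_N -> 'M[K]_m) (c : 'rV[R]_N) : 'M[K]_m :=
  \sum_k ofreal s (c 0 k) *: h k.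

Definition lie_basis G N (h : 'I_N -> lie G) :=
  forall x, lie G x -> exists! c : 'rV[R]_N, x = lcomb (val \o h) c.

Definition lcoord N (h : 'I_N -> 'M[K]_m) (x : 'M[K]_m) : 'rV[R]_N :=
  xget 0 [set c | x = lcomb h c].

(* matrix of [ad x] in the basis [h], coordinates being written as rows *)
Definition ad_mx N (h : 'I_N -> 'M[K]_m) (x : 'M[K]_m) : 'M[R]_N :=
  \matrix_i lcoord h (bracket x (h i)).

Definition killing N (h : 'I_N -> 'M[K]_m) (x y : 'M[K]_m) : R :=
  \tr (ad_mx h x *m ad_mx h y).

(* The Killing form of a compact semisimple group is negative definite, and
   orthonormality refers to its opposite. *)
Definition killing_orthonormal G N (h : 'I_N -> lie G) := forall i j,
  - killing (val \o h) (val (h i)) (val (h j)) = (i == j)%:R.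

Section GroupElements.
Variable G : matgroup R s m.

Definition gone : G := exist _ 1%:M (mem_set (gset1 G)).

Definition gmul (x y : G) : G :=
  exist _ (val x *m val y)
    (mem_set (gsetM (set_mem (valP x)) (set_mem (valP y)))).

Definition gexp (x : lie G) (t : R) : G :=
  exist _ (expm (ofreal s t *: val x)) (mem_set (set_mem (valP x) t)).

(* the left-invariant vector field associated with [x] *)
Definition lvf (x : lie G) (f : G -> K) : G -> K :=
  fun g => deriv0 (fun t => f (gmul g (gexp x t))).

Definition is_regular : {pred G -> K^o} := fun f => `[< polyfun val f >].

Lemma is_regularP (f : G -> K^o) :
  reflect (polyfun (val : G -> 'M[K]_m) f) (f \in is_regular).
Proof. exact: asboolP. Qed.

Lemma regular_submod : subsemimod_closed is_regular.
Proof.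
split; first split; first by apply/is_regularP; exact: polyfun_cst.
- move=> f g /is_regularP fr /is_regularP gr; apply/is_regularP.
  exact: polyfun_add.
- move=> c f /is_regularP fr; apply/is_regularP.
  exact: polyfun_mul (polyfun_cst _ c) fr.
Qed.

Lemma regular_mul : mulr_closed is_regular.
Proof.
split; first by apply/is_regularP; exact: polyfun_cst.
move=> f g /is_regularP fr /is_regularP gr; apply/is_regularP.
exact: polyfun_mul.
Qed.

HB.instance Definition _ :=
  GRing.isSubmodClosed.Build K (G -> K^o) is_regular regular_submod.
HB.instance Definition _ :=
  GRing.isMulClosed.Build (G -> K^o) is_regular regular_mul.

Record regfun := Regfun { rfun :> G -> K^o; rfunP : rfun \in is_regular }.
HB.instance Definition _ := [isSub for rfun].
HB.instance Definition _ := [Choice of regfun by <:].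
HB.instance Definition _ := [SubChoice_isSubLmodule of regfun by <:].
HB.instance Definition _ :=
  GRing.SubZmodule_isSubPzRing.Build _ _ regfun (GRing.subringClosedP _).
HB.instance Definition _ := GRing.SubPzRing_isSubComPzRing.Build _ _ regfun.

(* the function on [G * G] represented by an element of the tensor square *)
Definition tens_eval (t : tensor regfun regfun) (x y : G) : K :=
  lin_ext (fun ab : regfun * regfun => ab.1 x * ab.2 y : K^o) t.

Lemma tens_eval_rel x y z : @bilin_rel K regfun regfun z ->
  fglift (fun ab : regfun * regfun => ab.1 x * ab.2 y : K^o) z = 0.
Proof.
case=> [[c [a [b [v ->]]]]|[v [c [a [b ->]]]]];
  rewrite raddfB raddfB /= fglift_scale !liftU !scale1r /=.
- rewrite [X in X - _ - _](_ : _ = c *: (a x * v y : K^o) + b x * v y).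
    by rewrite addrAC addrK subrr.
  by rewrite [LHS]mulrDl -mulrA.
- rewrite [X in X - _ - _](_ : _ = c *: (v x * a y : K^o) + v x * b y).
    by rewrite addrAC addrK subrr.
  by rewrite [LHS]mulrDr mulrCA.
Qed.

Lemma tens_eval_tens a b x y : tens_eval (tens a b) x y = a x * b y.
Proof. by rewrite /tens_eval lin_ext_gen //; exact: tens_eval_rel. Qed.

Lemma tens_eval_lin c t t' x y :
  tens_eval (c *: t + t') x y = c * tens_eval t x y + tens_eval t' x y.
Proof. by rewrite /tens_eval lin_extP //; exact: tens_eval_rel. Qed.

(* [Delta f] is the element of the tensor square representing [f (x y)]; it
   exists by [reg_coprodP] and is unique since the tensor square embeds in the
   functions on [G * G]. *)
Definition reg_coprod (f : regfun) : tensor regfun regfun :=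
  xget 0 [set t | forall x y, tens_eval t x y = f (gmul x y)].

Lemma conjs_sumM (a b : 'I_m -> K) :
  conjs (\sum_k a k * b k) = \sum_k conjs (a k) * conjs (b k).
Proof.
case: s a b => //= a b.
by rewrite rmorph_sum; apply: eq_bigr => k _; rewrite rmorphM.
Qed.

Lemma coprod_split (f : G -> K) : polyfun val f ->
  exists r : seq (regfun * regfun),
    forall x y, f (gmul x y) = \sum_(ab <- r) ab.1 x * ab.2 y.
Proof.
have pf (F : G -> K^o) (Fr : polyfun val F) : F \in is_regular by apply/is_regularP.
pose C (c : K) : regfun := Regfun (pf _ (polyfun_cst _ c)).
pose coord i j : regfun := Regfun (pf _ (polyfun_coord _ i j)).
pose coordc i j : regfun := Regfun (pf _ (polyfun_conj _ i j)).
have sumE (F : 'I_m -> regfun * regfun) x y :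
  \sum_(ab <- [seq F k | k <- index_enum 'I_m]) ab.1 x * ab.2 y
  = \sum_k (F k).1 x * (F k).2 y by rewrite big_map.
elim=> [c|i j|i j|f1 f2 _ [r1 E1] _ [r2 E2]|f1 f2 _ [r1 E1] _ [r2 E2]].
- by exists [:: (C c, C 1)] => x y; rewrite big_seq1 /= mulr1.
- exists [seq (coord i k, coord k j) | k <- index_enum 'I_m] => x y.
  by rewrite sumE /= mxE.
- exists [seq (coordc i k, coordc k j) | k <- index_enum 'I_m] => x y.
  by rewrite sumE /= mxE conjs_sumM.
- by exists (r1 ++ r2) => x y; rewrite big_cat E1 E2.
- exists [seq (p.1 * q.1, p.2 * q.2) | p <- r1, q <- r2] => x y.
  rewrite big_allpairs_dep E1 E2 big_distrlr /=.
  by apply: eq_bigr => p _; apply: eq_bigr => q _; exact: mulrACA.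
Qed.

Lemma reg_coprodP f x y : tens_eval (reg_coprod f) x y = f (gmul x y).
Proof.
have [r fr] := coprod_split (elimT (is_regularP f) (rfunP f)).
suff ex : exists t, forall x y, tens_eval t x y = f (gmul x y).
  by have := @xgetPex _ 0 _ ex; exact.
exists (\sum_(ab <- r) tens ab.1 ab.2) => {}x {}y; rewrite fr.
elim: r {fr} => [|[a b] r IHr].
  have := tens_eval_lin (- 1) 0 0 x y.
  by rewrite scaler0 addr0 mulN1r addNr !big_nil.
by rewrite !big_cons -[tens _ _]scale1r tens_eval_lin tens_eval_tens mul1r IHr.
Qed.

Definition reg_counit (f : regfun) : K := f gone.

End GroupElements.
End MatrixGroups.

Section MA.
Variables (R : realType) (s : ground) (m : nat) (G : matgroup R s m).
Variables (n : nat) (X : manifold R n).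
Local Notation K := (scalar R s).

(* the graded vector space of differential forms on [X] *)
Definition deRham (p : nat) : lmodType K := diffform X s p.

Definition is_bialgebra_hom (M : regfun G -> bar deRham) := [/\
  forall (c : K) f g k, M (c *: f + g) k = c *: M f k + M g k,
  M 1 = bar_one deRham /\ forall f g, M (f * g) = bar_mul (M f) (M g),
  forall f, bar_counit (M f) = reg_counit f &
  forall f, deconc (M f) = bar_tens2 M (reg_coprod f)].

Definition MA N (h : 'I_N -> lie G) (A : 'I_N -> deRham 1) (f : regfun G) :
    bar deRham := fun k =>
  \sum_(t : k.-tuple 'I_N)
    foldr (fun i => lvf (h i)) (f : G -> K) t (gone G)
      *: tword [tuple of [seq mkletter (A i) | i <- t]].

End MA.

(* Main.v *)
Require Import Defs.
From HB Require Import structures.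
From mathcomp Require Import all_boot all_order all_algebra.
From mathcomp Require Import generic_quotient freeg complex ring.
From mathcomp Require Import boolp classical_sets functions reals.
From mathcomp Require Import topology normedtype sequences.

(** Write [X_t] for the composite of the left-invariant fields indexed by the
    letters of a word [t], and [c_t (f) = (X_t f) (e)].  The map sends [f] to the
    noncommutative power series with coefficients [c_t (f)] at the words
    [A_t], so each compatibility is a statement about the coefficients.

    - Multiplication.  The fields are derivations of the algebra of regular
      functions, so [X_t (f g)] is the sum of [X_u f * X_v g] over the ways of
      distributing the letters of [t] over two words [u] and [v]
      ([leibniz_foldr], [taylorM]).  The word [t] occurs in the shuffle product
      of [u] and [v] once for each such way ([sum_unshuffles]), and no sign
      appears because one-forms have degree [0] in the bar construction
      ([shuffles_degree0]).
    - Comultiplication.  If [f (x y) = sum a (x) b (y)], left invariance gives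
      [(X_v f) (x y) = sum a (x) (X_v b) (y)]; with [y = e] and then [X_u]
      applied at [e], [c_uv (f) = sum c_u (a) c_v (b)] ([lderiv_translate],
      [taylor_cat]), which is the coefficient of the deconcatenation at the
      pair [(u, v)].
    - Unit and counit.  A derivation kills [1] and [c] of the empty word is
      evaluation at [e].

    The analytic input is that the limits defining the fields exist on regular
    functions.  By the coproduct formula this reduces to the unit ([lvf_split]),
    then by the Leibniz rule to the matrix coordinates and their conjugates,
    and finally to the first-order expansion of the matrix exponential
    ([expm_taylor1]), which is proved entrywise by domination by exponential
    series.  The same reduction shows that the fields preserve regular
    functions ([lvf_regular]).

    The algebraic input is that the operations of the bar construction, given
    on words, are linear on sums of words.  For the shuffle product this is the
    multilinearity of [shuffle_sum]. *)

Set Implicit Arguments.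
Unset Strict Implicit.
Unset Printing Implicit Defensive.

Import Order.TTheory GRing.Theory Num.Theory.
Import numFieldNormedType.Exports.

Local Open Scope classical_set_scope.
Local Open Scope ring_scope.

(** * Words, their interleavings and the Leibniz rule *)

Section TupleSums.
Variables (I : finType) (V : nmodType).

Lemma big_tuple0 (F : seq I -> V) : \sum_(t : 0.-tuple I) F t = F [::].
Proof.
rewrite (bigD1 [tuple]) //= big1 ?addr0 // => t.
by rewrite (tuple0 t) => /eqP.
Qed.

Lemma big_tupleS k (F : seq I -> V) :
  \sum_(t : k.+1.-tuple I) F t = \sum_(a : I) \sum_(t : k.-tuple I) F (a :: t).
Proof.
rewrite pair_big /=.
rewrite (reindex (fun p : I * k.-tuple I => [tuple of p.1 :: p.2])) //=.
exists (fun t => (thead t, [tuple of behead t])) => [[a t] _|t _] /=.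
  by congr (_, _); apply/val_inj.
by rewrite [in RHS](tuple_eta t).
Qed.

Lemma big_tuple_cat p q (F : seq I -> V) :
  \sum_(t : (p + q).-tuple I) F t
  = \sum_(u : p.-tuple I) \sum_(v : q.-tuple I) F (u ++ v).
Proof.
elim: p F => [|p IHp] F.
  by rewrite (big_tuple0 (fun u => \sum_(v : q.-tuple I) F (u ++ v))).
rewrite (big_tupleS _ (fun u => \sum_(v : q.-tuple I) F (u ++ v))).
rewrite (big_tupleS (p + q)); apply: eq_bigr => a _.
by rewrite (IHp (fun w => F (a :: w))).
Qed.

End TupleSums.

Section Shuffles.
Variable I : finType.

(** This is the combinatorics of the Leibniz rule: each operator of a composite
    [w] of derivations acts on one of the two factors of a product.  A pair is
    listed as many times as it arises. *)
Fixpoint unshuffles (w : seq I) : seq (seq I * seq I) :=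
  if w is a :: w' then
    [seq (a :: p.1, p.2) | p <- unshuffles w'] ++
    [seq (p.1, a :: p.2) | p <- unshuffles w']
  else [:: ([::], [::])].

(** The words of the shuffle product, without their Koszul signs. *)
Fixpoint interleavings (u : seq I) : seq I -> seq (seq I) :=
  if u is a :: u' then
    fix interleavings_u v := if v is b :: v' then
        [seq a :: w | w <- interleavings u' v]
        ++ [seq b :: w | w <- interleavings_u v']
      else [:: u]
  else fun v => [:: v].

Variable V : nmodType.

Let T i j (F : seq I -> seq I -> seq I -> V) :=
  \sum_(u : i.-tuple I) \sum_(v : j.-tuple I) \sum_(w <- interleavings u v) F u v w.

(* An interleaving of [u] and [v] begins with the first letter of [u] or with
   that of [v]. *)
Let T_split i j F : (0 < i + j)%N -> T i j F =
  (if i is i'.+1 then \sum_a T i' j (fun u v w => F (a :: u) v (a :: w)) else 0)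
  + (if j is j'.+1 then \sum_b T i j' (fun u v w => F u (b :: v) (b :: w))
     else 0).
Proof.
case: i j => [|i] [|j] // _; rewrite /T ?add0r ?addr0.
- pose G u := \sum_(v : j.+1.-tuple I) \sum_(w <- interleavings u v) F u v w.
  rewrite (big_tuple0 G) /G (big_tupleS _ (fun v => \sum_(w <- [:: v]) F [::] v w)).
  apply: eq_bigr => b _.
  pose G' u := \sum_(v : j.-tuple I)
    \sum_(w <- interleavings u v) F u (b :: v) (b :: w).
  rewrite (big_tuple0 G') /G'; apply: eq_bigr => v _ /=.
  by rewrite !big_seq1.
- pose G u := \sum_(v : 0.-tuple I) \sum_(w <- interleavings u v) F u v w.
  rewrite (big_tupleS _ G) /G; apply: eq_bigr => a _; apply: eq_bigr => u _.
  rewrite (big_tuple0 (fun v =>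
    \sum_(w <- interleavings (a :: u) v) F (a :: u) v w)).
  rewrite (big_tuple0 (fun v =>
    \sum_(w <- interleavings u v) F (a :: u) v (a :: w))) /=.
  by case: (u : seq I) => [|c u'] /=; rewrite !big_seq1.
- pose G u := \sum_(v : j.+1.-tuple I) \sum_(w <- interleavings u v) F u v w.
  have GE a u : G (a :: u) =
     (\sum_(v : j.+1.-tuple I)
        \sum_(w <- interleavings u v) F (a :: u) v (a :: w))
     + \sum_b \sum_(v : j.-tuple I) \sum_(w <- interleavings (a :: u) v)
         F (a :: u) (b :: v) (b :: w).
    rewrite /G.
    rewrite (big_tupleS _ (fun v =>
      \sum_(w <- interleavings (a :: u) v) F (a :: u) v w)).
    rewrite (big_tupleS _ (fun v =>
      \sum_(w <- interleavings u v) F (a :: u) v (a :: w))).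
    rewrite -big_split; apply: eq_bigr => b _; rewrite -big_split.
    by apply: eq_bigr => v _; rewrite [interleavings _ _]/= big_cat !big_map.
  rewrite (big_tupleS _ G).
  under eq_bigr => a _ do
    (under eq_bigr => u _ do rewrite GE; rewrite big_split).
  rewrite big_split /=; congr (_ + _).
  rewrite [RHS](eq_bigr (fun b => \sum_a \sum_(u : i.-tuple I)
    \sum_(v : j.-tuple I) \sum_(w <- interleavings (a :: u) v)
      F (a :: u) (b :: v) (b :: w))); last first.
    move=> b _; exact: (big_tupleS _ (fun u =>
      \sum_(v : j.-tuple I) \sum_(w <- interleavings u v) F u (b :: v) (b :: w))).
  rewrite [RHS]exchange_big; apply: eq_bigr => a _; exact: exchange_big.
Qed.

(** Distributing the letters of [t] over two words is inverse to interleaving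
    two words, so both sides sum over the triples [(u, v, t)] such that [t]
    interleaves [u] and [v].  The induction removes the first letter of [t],
    which is the first letter of [u] or of [v]. *)
Lemma sum_unshuffles k (F : seq I -> seq I -> seq I -> V) :
  \sum_(t : k.-tuple I) \sum_(p <- unshuffles t) F p.1 p.2 t
  = \sum_(i < k.+1) \sum_(u : i.-tuple I) \sum_(v : (k - i).-tuple I)
      \sum_(w <- interleavings u v) F u v w.
Proof.
have -> : \sum_(i < k.+1) \sum_(u : i.-tuple I) \sum_(v : (k - i).-tuple I)
      \sum_(w <- interleavings u v) F u v w = \sum_(i < k.+1) T i (k - i) F by [].
elim: k F => [|k IHk] F.
  rewrite (big_tuple0 (fun t => \sum_(p <- unshuffles t) F p.1 p.2 t)) big_ord1 /T.
  rewrite (big_tuple0 (fun u =>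
    \sum_(v : 0.-tuple I) \sum_(w <- interleavings u v) F u v w)).
  rewrite (big_tuple0 (fun v => \sum_(w <- interleavings [::] v) F [::] v w)).
  by rewrite !big_seq1.
rewrite (big_tupleS _ (fun t => \sum_(p <- unshuffles t) F p.1 p.2 t)).
transitivity (\sum_a
  (\sum_(i < k.+1) T i (k - i) (fun u v w => F (a :: u) v (a :: w))
  + \sum_(i < k.+1) T i (k - i) (fun u v w => F u (a :: v) (a :: w)))).
  apply: eq_bigr => a _; rewrite -!IHk -big_split; apply: eq_bigr => t _.
  by rewrite big_cat !big_map.
(* On the right, the terms whose first letter is in [u] have [i > 0] and those
   whose first letter is in [v] have [i <= k]: the extreme terms vanish and the
   first family is reindexed by [i - 1]. *)
rewrite big_split /=.
have i_le (i : 'I_k.+2) : (0 < i + (k.+1 - i))%N by rewrite subnKC // -ltnS.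
rewrite [RHS](eq_bigr _ (fun i _ => T_split F (i_le i))).
rewrite [RHS]big_split [X in _ = X + _]big_ord_recl [X in _ = _ + X]big_ord_recr.
rewrite /= add0r subnn addr0.
rewrite [X in X + _ = _]exchange_big [X in _ + X = _]exchange_big; congr (_ + _).
by apply: eq_bigr => i _ /=; rewrite subSn // -ltnS.
Qed.

End Shuffles.

Section Derivations.
Variables (I : finType) (A : pzRingType) (D : I -> A -> A).
Hypothesis D_add : forall i, {morph D i : f g / f + g}.
Hypothesis D_leibniz : forall i f g, D i (f * g) = D i f * g + f * D i g.

Lemma leibniz_foldr (t : seq I) f g :
  foldr D (f * g) t = \sum_(p <- unshuffles t) foldr D f p.1 * foldr D g p.2.
Proof.
have D0 i : D i 0 = 0 by apply: (addrI (D i 0)); rewrite -D_add !addr0.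
elim: t => [|i t IHt] /=; first by rewrite big_seq1.
rewrite IHt (big_morph _ (D_add i) (D0 i)) big_cat !big_map /= -big_split /=.
by apply: eq_bigr => p _; exact: D_leibniz.
Qed.
End Derivations.

(** * Real and complex scalars *)

Section Scalars.
Variables (R : realType) (s : ground).
Local Notation K := (Defs.scalar R s).
Local Notation ofr := (@ofreal R s).

Fact ofreal_is_zmod_morphism : zmod_morphism ofr.
Proof. by case: s => // x y; exact: (rmorphB (real_complex R)). Qed.
Fact ofreal_is_monoid_morphism : monoid_morphism ofr.
Proof.
by case: s; split=> // x y; exact: (rmorphM (real_complex R)).
Qed.
HB.instance Definition _ :=
  GRing.isZmodMorphism.Build R K (@ofreal R s) ofreal_is_zmod_morphism.
HB.instance Definition _ :=
  GRing.isMonoidMorphism.Build R K (@ofreal R s) ofreal_is_monoid_morphism.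

Lemma ler_ofreal x y : (ofr x <= ofr y) = (x <= y).
Proof. by case: s => //; exact: lecR. Qed.

Lemma ltr_ofreal x y : (ofr x < ofr y) = (x < y).
Proof. by case: s => //; exact: ltcR. Qed.

Lemma normr_ofreal x : `|ofr x| = ofr `|x|.
Proof. by case: s => //; rewrite /= normc_def /= expr0n addr0 sqrtr_sqr. Qed.

Lemma normr_scalar (z : K) : exists r, `|z| = ofr r.
Proof.
case: s z => z; first by exists `|z|.
exists (Num.sqrt (complex.Re z ^+ 2 + complex.Im z ^+ 2)); exact: normc_def.
Qed.

Lemma conjs_is_zmod_morphism : zmod_morphism (@conjs R s).
Proof. by case: s => // x y; exact: (rmorphB (@conjc R)). Qed.
Lemma conjs_is_monoid_morphism : monoid_morphism (@conjs R s).
Proof.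
case: s; split=> // *; first exact: (rmorph1 (@conjc R)).
exact: (rmorphM (@conjc R)).
Qed.
HB.instance Definition _ :=
  GRing.isZmodMorphism.Build K K (@conjs R s) conjs_is_zmod_morphism.
HB.instance Definition _ :=
  GRing.isMonoidMorphism.Build K K (@conjs R s) conjs_is_monoid_morphism.

Lemma normr_conjs (z : K) : `|conjs z| = `|z|.
Proof. by case: s z => //= -[a b]; rewrite !normc_def /= sqrrN. Qed.

Lemma conjs_ofreal x : conjs (ofr x) = ofr x.
Proof. by case: s => //=; exact: conjc_real. Qed.

(** Norms in the ground field are images of real numbers, so that real radii
    suffice to test convergence. *)
Lemma cvg_scalar (T : Type) (F : set_system T) (FF : Filter F) (f : T -> K) l :
  (forall e : R, 0 < e -> \forall t \near F, `|l - f t| < ofr e) -> f @ F --> l.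
Proof.
move=> H; apply/cvgrPdist_lt => e e0; have [r er] := normr_scalar e.
rewrite gtr0_norm // in er; rewrite er in e0 *; apply: H.
by rewrite -ltr_ofreal rmorph0.
Qed.

End Scalars.

(** Dominated series converge in both ground fields: over the complex numbers
    the real and the imaginary parts are dominated real series. *)
Lemma scalar_dominated_cvg (R : realType) (s : ground)
    (a : nat -> Defs.scalar R s) (b : nat -> R) :
  cvgn (series b) -> (forall k, `|a k| <= ofreal s (b k)) -> cvgn (series a).
Proof.
case: s a => a bcv ab.
  apply: normed_cvg; apply: series_le_cvg bcv => //= k.
  exact: le_trans (ab k).
have {}ab k : Num.sqrt (complex.Re (a k) ^+ 2 + complex.Im (a k) ^+ 2) <= b k.
  by have := ab k; rewrite normc_def lecR.
have b_ge0 k : 0 <= b k by apply: le_trans (sqrtr_ge0 _) (ab k).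
have part (p : R[i] -> R) :
    (forall z, p z ^+ 2 <= complex.Re z ^+ 2 + complex.Im z ^+ 2) ->
    cvgn (series (p \o a)).
  move=> ple; apply: normed_cvg; apply: series_le_cvg bcv => //= k.
  by apply: le_trans (ab k); rewrite -sqrtr_sqr ler_wsqrtr.
have /cvg_ex[x xl] : cvgn (series (@complex.Re R \o a)).
  by apply: part => z; rewrite lerDl sqr_ge0.
have /cvg_ex[y yl] : cvgn (series (@complex.Im R \o a)).
  by apply: part => z; rewrite lerDr sqr_ge0.
apply/cvg_ex; exists (Complex x y); apply: (@cvg_scalar R Complexes) => e e0.
have e2 : 0 < e / 2 by rewrite divr_gt0.
move/cvgrPdist_lt: xl => /(_ _ e2) xl; move/cvgrPdist_lt: yl => /(_ _ e2) yl.
have seriesE k : series a k = Complex (series (@complex.Re R \o a) k)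
                                    (series (@complex.Im R \o a) k).
  rewrite /series /=; elim: k => [|k IHk]; first by rewrite !big_geq.
  by rewrite !big_nat_recr //= IHk; case: (a k).
have diffE u v : Complex x y - Complex u v
   = real_complex R (x - u) + Complex 0 1 * real_complex R (y - v).
  by apply/eqP; rewrite eq_complex /=; apply/andP; split; apply/eqP; ring.
near=> k; rewrite seriesE diffE.
apply: le_lt_trans (ler_normD _ _) _; rewrite normrM.
have -> : `|Complex 0 1 : R[i]| = 1.
  by rewrite normc_def /= expr0n expr1n add0r sqrtr1.
rewrite mul1r !(@normr_ofreal R Complexes) -(rmorphD (real_complex R)) ltcR.
rewrite (splitr e); apply: ltrD; near: k; [exact: xl | exact: yl].
Unshelve. all: by end_near. Qed.

(** * The matrix exponential near zero *)

Section Exponential.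
Variables (R : realType) (s : ground) (m : nat).
Local Notation K := (Defs.scalar R s).
Local Notation ofr := (@ofreal R s).
Implicit Types x : 'M[K]_m.

Lemma cvg_norm_le (T : Type) (F : set_system T) (FF : ProperFilter F)
    (u : T -> K) (l a : K) (B : R) :
  u @ F --> l -> (\forall t \near F, `|u t - a| <= ofr B) -> `|l - a| <= ofr B.
Proof.
move=> /cvgrPdist_lt ul uB; have [r rE] := normr_scalar (l - a).
rewrite rE ler_ofreal; apply/ler_addgt0Pr => e e0.
have e0' : 0 < ofr e by rewrite -(rmorph0 ofr) ltr_ofreal.
near F => t; rewrite -(@ler_ofreal R s) -rE -(subrKA (u t)) rmorphD [leRHS]addrC.
apply: le_trans (ler_normD _ _) _; apply: lerD; last by near: t.
by apply: ltW; near: t; exact: ul.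
Unshelve. all: by end_near. Qed.

Lemma norm_mx_bounded x : exists2 c, 0 <= c & forall i j, `|x i j| <= ofr c.
Proof.
pose S := \sum_i \sum_j `|x i j|.
have S0 : 0 <= S by apply: sumr_ge0 => i _; exact: sumr_ge0.
have [c cE] := normr_scalar S; rewrite ger0_norm // in cE.
exists c => [|i j]; first by rewrite -(@ler_ofreal R s) rmorph0 -cE.
rewrite -cE /S (bigD1 i) //= (bigD1 j) //= -addrA lerDl addr_ge0 //.
  exact: sumr_ge0.
by apply: sumr_ge0 => k _; exact: sumr_ge0.
Qed.

(** The factor [m] accounts for the [m] summands of each entry of a product. *)
Lemma norm_exp_mx_le x (c : R) : (forall i j, `|x i j| <= ofr c) ->
  forall k i j, `|(x ^+ k) i j| <= ofr ((m%:R * c) ^+ k).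
Proof.
move=> xc; elim=> [|k IHk] i j.
  rewrite !expr0 mxE rmorph1; case: (i == j); first by rewrite normr1.
  by rewrite normr0 ler01.
rewrite exprS [(x * _) i j]mxE; apply: le_trans (ler_norm_sum _ _ _) _.
have -> : ofr ((m%:R * c) ^+ k.+1) = \sum_(l < m) ofr c * ofr ((m%:R * c) ^+ k).
  by rewrite sumr_const card_ord -rmorphM -rmorphMn exprS -mulrA mulr_natl.
by apply: ler_sum => l _; rewrite normrM ler_pM.
Qed.

Lemma exp_coeffMl (a b : R) k : exp_coeff (a * b) k = a ^+ k * exp_coeff b k.
Proof. by rewrite /exp_coeff /= exprMn mulrA. Qed.

Definition exp_term x k : 'M[K]_m := (k`!%:R)^-1 *: x ^+ k.

Lemma norm_exp_term_le x (c : R) : (forall i j, `|x i j| <= ofr c) ->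
  forall k i j, `|exp_term x k i j| <= ofr (exp_coeff (m%:R * c) k).
Proof.
move=> xc k i j; rewrite mxE normrM [leLHS]mulrC /exp_coeff /= rmorphM.
rewrite fmorphV rmorph_nat normfV normr_nat ler_wpM2r ?invr_ge0 //.
exact: norm_exp_mx_le.
Qed.

(** The exponential is defined by a limit of matrices, which carries information
    only once the series is known to converge; this follows from the
    convergence of each entry, dominated by an exponential series. *)
Lemma expm_cvg x i j :
  series (fun k => exp_term x k i j) n @[n --> \oo] --> expm x i j.
Proof.
have [c _ xc] := norm_mx_bounded x.
have cvE a b : cvgn (series (fun k => exp_term x k a b)).
  apply: (scalar_dominated_cvg (is_cvg_series_exp_coeff (m%:R * c))) => k.
  exact: norm_exp_term_le.
have sE a b : (fun n => series (exp_term x) n a b)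
            = series (fun k => exp_term x k a b).
  by apply/funext => n; rewrite /series /= summxE.
pose M := \matrix_(a, b) limn (series (fun k => exp_term x k a b)).
have cvM : series (exp_term x) n @[n --> \oo] --> M.
  move=> A [P MP sPA].
  have : \forall n \near \oo, forall a b, P a b (series (exp_term x) n a b).
    apply: filter_forall => a; apply: filter_forall => b.
    have := cvE a b; rewrite -sE => /(_ (P a b)); apply.
    by have := MP a b; rewrite mxE -sE.
  by apply: filterS => n; exact: sPA.
have := cvgP _ cvM; rewrite -sE => cvx.
exact: (cvg_comp _ _ cvx (@coord_continuous _ _ _ i j (expm x))).
Qed.

(** All that is needed of the exponential: its value and its derivative at [0].
    After the terms of degree [0] and [1], the series is dominated by [t ^+ 2]
    times an exponential series independent of [t]. *)
Lemma expm_taylor1 x : exists C, forall t : R, `|t| <= 1 -> forall i j,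
  `|expm (ofr t *: x) i j - (1%:M i j + ofr t * x i j)| <= ofr (t ^+ 2 * C).
Proof.
have [c c0 xc] := norm_mx_bounded x.
set d := m%:R * c; have d0 : 0 <= d by rewrite mulr_ge0.
exists (limn (series (exp_coeff d))) => t t1 i j.
apply: (cvg_norm_le _ (@expm_cvg _ i j)).
exists 2 => //= n n2; rewrite /series /= big_ltn 1?big_ltn //; last exact: ltnW.
have -> : exp_term (ofr t *: x) 0 i j = 1%:M i j.
  by rewrite /exp_term invr1 scale1r expr0.
have -> : exp_term (ofr t *: x) 1 i j = ofr t * x i j.
  by rewrite /exp_term invr1 scale1r expr1 mxE.
rewrite addrA [_ + _ - _]addrC addKr.
apply: le_trans (ler_norm_sum _ _ _) _.
have tx a b : `|(ofr t *: x) a b| <= ofr (`|t| * c).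
  by rewrite mxE normrM rmorphM /= -normr_ofreal ler_wpM2l.
have lim_ge : (\sum_(2 <= k < n) exp_coeff d k) <= limn (series (exp_coeff d)).
  apply: (@le_trans _ _ (series (exp_coeff d) n)).
    rewrite /series /= [leRHS](big_cat_nat (n := 2)) //= lerDr.
    by apply: sumr_ge0 => k _; exact: exp_coeff_ge0.
  apply: nondecreasing_cvgn_le; last exact: is_cvg_series_exp_coeff.
  by apply: nondecreasing_series => k _ _; exact: exp_coeff_ge0.
apply: le_trans (_ : (\sum_(2 <= k < n) ofr (t ^+ 2 * exp_coeff d k)) <= _); last first.
  by rewrite -rmorph_sum -mulr_sumr ler_ofreal ler_wpM2l // sqr_ge0.
apply: ler_sum_nat => k /andP[k2 _].
apply: le_trans (norm_exp_term_le tx k i j) _; rewrite ler_ofreal.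
rewrite mulrCA exp_coeffMl; apply: ler_wpM2r; first exact: exp_coeff_ge0.
by rewrite -real_normK ?num_real // ler_wiXn2l.
Qed.
End Exponential.

(** * Derivatives along one-parameter subgroups *)

Section Derivatives.
Variables (R : realType) (s : ground).
Local Notation K := (Defs.scalar R s).
Local Notation ofr := (@ofreal R s).
Implicit Types (f g : R -> K) (a b : K).

Definition has_deriv0 f a := dquot f t @[t --> (0 : R)^'] --> a.

Lemma deriv0E f a : has_deriv0 f a -> Defs.deriv0 f = a.
Proof. by move=> fa; apply: cvg_lim fa; exact: norm_hausdorff. Qed.

Lemma has_deriv0_cst a : has_deriv0 (fun=> a) 0.
Proof.
rewrite /has_deriv0 (_ : dquot _ = fun=> 0); first exact: cvg_cst.
by apply/funext => t; rewrite /dquot subrr mulr0.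
Qed.

Lemma has_deriv0D f g a b : has_deriv0 f a -> has_deriv0 g b ->
  has_deriv0 (fun t => f t + g t) (a + b).
Proof.
move=> fa gb; rewrite /has_deriv0.
rewrite (_ : dquot _ = fun t => dquot f t + dquot g t); first exact: cvgD.
by apply/funext => t; rewrite /dquot -mulrDr; congr (_ * _); ring.
Qed.

(** Multiplying the difference quotient back by [t]. *)
Lemma has_deriv0_cvg f a : has_deriv0 f a -> f t @[t --> (0 : R)^'] --> f 0.
Proof.
move=> fa.
have fE : f = fun t => f 0 + ofr t * dquot f t.
  apply/funext => t; rewrite /dquot; have [->|t0] := eqVneq t 0.
    by rewrite rmorph0 mul0r addr0.
  by rewrite mulVKf ?fmorph_eq0 // addrC subrK.
have ofr0 : ofr t @[t --> (0 : R)^'] --> (0 : K).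
  apply: cvg_scalar => e e0; apply: filterS (dnbhs0_lt e0) => t te.
  by rewrite sub0r normrN normr_ofreal ltr_ofreal.
rewrite [X in X @ _]fE -[X in _ --> X]addr0 -(mul0r a).
by apply: cvgD; [exact: cvg_cst | exact: cvgM].
Qed.

Lemma has_deriv0M f g a b : has_deriv0 f a -> has_deriv0 g b ->
  has_deriv0 (fun t => f t * g t) (a * g 0 + f 0 * b).
Proof.
move=> fa gb; rewrite /has_deriv0.
rewrite (_ : dquot _ = fun t => dquot f t * g t + f 0 * dquot g t).
  by apply: cvgD; apply: cvgM => //; [exact: has_deriv0_cvg gb|exact: cvg_cst].
by apply/funext => t; rewrite /dquot; ring.
Qed.

Lemma has_deriv0Z f a c : has_deriv0 f a -> has_deriv0 (fun t => c * f t) (c * a).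
Proof.
by move=> fa; have := has_deriv0M (has_deriv0_cst c) fa; rewrite mul0r add0r.
Qed.

Lemma has_deriv0_sum (T : Type) (r : seq T) (F : T -> R -> K) (a : T -> K) :
  (forall i, has_deriv0 (F i) (a i)) ->
  has_deriv0 (fun t => \sum_(i <- r) F i t) (\sum_(i <- r) a i).
Proof.
move=> Fa; elim: r => [|i r IHr].
  rewrite big_nil (_ : (fun t => _) = fun=> 0); first exact: has_deriv0_cst.
  by apply/funext => t; rewrite big_nil.
rewrite big_cons (_ : (fun t => _) = fun t => F i t + \sum_(j <- r) F j t).
  exact: has_deriv0D.
by apply/funext => t; rewrite big_cons.
Qed.

(** Derivatives are taken along a real parameter, so complex conjugation
    commutes with them although it is not holomorphic. *)
Lemma has_deriv0_conj f a : has_deriv0 f a ->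
  has_deriv0 (fun t => conjs (f t)) (conjs a).
Proof.
move=> fa; rewrite /has_deriv0.
rewrite (_ : dquot _ = fun t => conjs (dquot f t)).
  move/cvgrPdist_lt: fa => fa; apply/cvgrPdist_lt => e e0.
  by apply: filterS (fa e e0) => t; rewrite -rmorphB normr_conjs.
by apply/funext => t; rewrite /dquot rmorphM rmorphB fmorphV /= conjs_ofreal.
Qed.

Lemma expm0 m : expm (0 : 'M[K]_m) = 1%:M.
Proof.
apply/matrixP => i j; have [C] := expm_taylor1 (0 : 'M[K]_m).
have n0 : `|0 : R| <= 1 by rewrite normr0.
move=> /(_ 0 n0 i j); rewrite scaler0 rmorph0 mul0r addr0 expr0n mul0r rmorph0.
by rewrite normr_le0 subr_eq0 => /eqP.
Qed.

Lemma has_deriv0_expm m (x : 'M[K]_m) i j :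
  has_deriv0 (fun t => expm (ofr t *: x) i j) (x i j).
Proof.
have [C xC] := expm_taylor1 x.
apply: cvg_scalar => e e0.
have C0 : 0 < 1 + `|C| by rewrite ltr_pwDl.
have d0 : 0 < Num.min 1 (e / (1 + `|C|)) by rewrite lt_min ltr01 divr_gt0.
near=> t.
have t0 : t != 0 by near: t; exact: nbhs_dnbhs_neq.
have : `|t| < Num.min 1 (e / (1 + `|C|)) by near: t; exact: dnbhs0_lt.
rewrite lt_min ltr_pdivlMr // => /andP[t1 te].
have := xC t (ltW t1) i j; rewrite /dquot rmorph0 scale0r expm0 => le.
have -> : x i j - (ofr t)^-1 * (expm (ofr t *: x) i j - 1%:M i j)
  = - (ofr t)^-1 * (expm (ofr t *: x) i j - (1%:M i j + ofr t * x i j)).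
  by rewrite mulNr opprD addrA [in RHS]mulrBr mulKf ?fmorph_eq0 // opprB.
rewrite normrM normrN normfV normr_ofreal.
rewrite ltr_pdivrMl; last by rewrite -(rmorph0 ofr) ltr_ofreal normr_gt0.
apply: le_lt_trans le _; rewrite -rmorphM ltr_ofreal -real_normK ?num_real //.
rewrite expr2 -mulrA ltr_pM2l ?normr_gt0 //; apply: le_lt_trans te.
by rewrite ler_wpM2l // (le_trans (ler_norm C)) // lerDr.
Unshelve. all: by end_near. Qed.

End Derivatives.

(** * Left-invariant fields on regular functions *)

Section InvariantFields.
Variables (R : realType) (s : ground) (m : nat) (G : matgroup R s m).
Local Notation K := (Defs.scalar R s).
Local Notation ofr := (@ofreal R s).
Local Notation gone := (gone G).
Implicit Types (x : lie G) (f g : regfun G) (p q : G).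

Lemma gexp0 x : gexp x 0 = gone.
Proof. by apply/val_inj; rewrite /= rmorph0 scale0r expm0. Qed.

Lemma gmulx1 p : gmul p gone = p.
Proof. by apply/val_inj; rewrite /= mulmx1. Qed.

Lemma gmul1x p : gmul gone p = p.
Proof. by apply/val_inj; rewrite /= mul1mx. Qed.

Lemma gmulA : associative (@gmul R s m G).
Proof. by move=> p q r; apply/val_inj; rewrite /= mulmxA. Qed.

(** Sums and products preserve differentiability along a curve, so only the
    coordinates [u_ij] and their conjugates matter. *)
Lemma polyfun_has_deriv0 x (f : G -> K) : polyfun val f ->
  exists a, has_deriv0 (fun t => f (gexp x t)) a.
Proof.
elim=> [c|i j|i j|f1 f2 _ [a1 E1] _ [a2 E2]|f1 f2 _ [a1 E1] _ [a2 E2]].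
- by exists 0; exact: has_deriv0_cst.
- by exists (val x i j); exact: has_deriv0_expm.
- by exists (conjs (val x i j)); apply: has_deriv0_conj; exact: has_deriv0_expm.
- by exists (a1 + a2); exact: has_deriv0D.
- by eexists; exact: has_deriv0M E1 E2.
Qed.

Lemma lvf1_has_deriv0 x f : has_deriv0 (fun t => f (gexp x t)) (lvf x f gone).
Proof.
have [a fa] := polyfun_has_deriv0 x (elimT (is_regularP f) (rfunP f)).
rewrite /lvf (_ : (fun t => _) = fun t => f (gexp x t)) ?(deriv0E fa) //.
by apply/funext => t; rewrite gmul1x.
Qed.

(** Translating [f] by [p] and using its coproduct turns the derivative at [p]
    into derivatives at the unit. *)
Lemma lvf_split x (f : G -> K) (r : seq (regfun G * regfun G)) p :
  (forall q, f (gmul p q) = \sum_(ab <- r) ab.1 p * ab.2 q) ->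
  has_deriv0 (fun t => f (gmul p (gexp x t)))
    (\sum_(ab <- r) ab.1 p * lvf x ab.2 gone).
Proof.
move=> fr; rewrite (_ : (fun t => _) = fun t =>
  \sum_(ab <- r) ab.1 p * ab.2 (gexp x t)); last by apply/funext => t.
by apply: has_deriv0_sum => ab; apply: has_deriv0Z; exact: lvf1_has_deriv0.
Qed.

Lemma lvf_has_deriv0 x f p :
  has_deriv0 (fun t => f (gmul p (gexp x t))) (lvf x f p).
Proof.
have [r fr] := coprod_split (elimT (is_regularP f) (rfunP f)).
by have fp := @lvf_split x _ _ _ (fr p); rewrite /lvf (deriv0E fp).
Qed.

(** By [lvf_split], [X f = sum f' (X f'') (e)] when the coproduct of [f] is
    [sum f' \otimes f'']: a left-invariant field maps regular functions to
    regular functions. *)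
Lemma lvf_regular x f : (lvf x f : G -> K^o) \in @is_regular R s m G.
Proof.
have [r fr] := coprod_split (elimT (is_regularP f) (rfunP f)).
have -> : lvf x f = \sum_(ab <- r) (lvf x ab.2 gone) *: (ab.1 : G -> K^o).
  apply/funext => p; rewrite fct_sumE {1}/lvf (deriv0E (@lvf_split x _ _ _ (fr p))).
  by apply: eq_bigr => ab _; rewrite mulrC.
by apply: rpred_sum => ab _; apply: rpredZ; exact: rfunP.
Qed.

Definition lderiv x f : regfun G := Regfun (lvf_regular x f).

Lemma lderiv_linear x c f g : lderiv x (c *: f + g) = c *: lderiv x f + lderiv x g.
Proof.
apply/val_inj/funext => p; apply: deriv0E.
by apply: has_deriv0D; [apply: has_deriv0Z|]; exact: lvf_has_deriv0.
Qed.

Lemma lderivD x : {morph lderiv x : f g / f + g}.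
Proof. by move=> f g; have := lderiv_linear x 1 f g; rewrite !scale1r. Qed.

Lemma lderivM x f g : lderiv x (f * g) = lderiv x f * g + f * lderiv x g.
Proof.
apply/val_inj/funext => p; apply: deriv0E.
have := has_deriv0M (@lvf_has_deriv0 x f p) (@lvf_has_deriv0 x g p).
by rewrite gexp0 gmulx1.
Qed.

(** Left invariance: a left-invariant field acts on the second factor of the
    coproduct. *)
Lemma lderiv_translate x f (r : seq (regfun G * regfun G)) :
  (forall p q, f (gmul p q) = \sum_(ab <- r) ab.1 p * ab.2 q) ->
  forall p q, lderiv x f (gmul p q) = \sum_(ab <- r) ab.1 p * lderiv x ab.2 q.
Proof.
move=> fr p q; apply: deriv0E.
rewrite (_ : (fun t => _) = fun t =>
    \sum_(ab <- r) ab.1 p * ab.2 (gmul q (gexp x t))).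
  by apply: has_deriv0_sum => ab; apply: has_deriv0Z; exact: lvf_has_deriv0.
by apply/funext => t; rewrite -gmulA fr.
Qed.

End InvariantFields.

(** * Linear maps out of presented spaces and tensor products *)

Local Open Scope quotient_scope.

Section LinearMaps.
Variables (K : fieldType) (S : choiceType) (rel : set {freeg S / K}).
Variables (M : lmodType K) (phi : S -> M).
Hypothesis phi_rel : forall z, rel z -> fglift phi z = 0.

(** [lin_ext] is computed on representatives, so its linearity rests on the
    compatibility of [phi] with the relations. *)
Lemma lin_ext_sum (T : Type) (r : seq T) (c : T -> K) (x : T -> presented rel) :
  lin_ext phi (\sum_(i <- r) c i *: x i) = \sum_(i <- r) c i *: lin_ext phi (x i).
Proof.
elim: r => [|i r IHr]; last by rewrite !big_cons lin_extP // IHr.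
rewrite !big_nil; have := lin_extP phi_rel (-1) 0 0.
by rewrite !scaleN1r oppr0 addr0 addNr.
Qed.

End LinearMaps.

Section TensorSums.
Variables (K : fieldType) (U V : lmodType K).

Lemma tens_suml (T : Type) (r : seq T) (c : T -> K) (x : T -> U) (v : V) :
  tens (\sum_(i <- r) c i *: x i) v = \sum_(i <- r) c i *: tens (x i) v.
Proof.
elim: r => [|i r IHr]; last by rewrite !big_cons tensDl IHr.
rewrite !big_nil; have := tensDl (-1) (0 : U) 0 v.
by rewrite !scaleN1r oppr0 addr0 addNr.
Qed.

Lemma tens_sumr (T : Type) (r : seq T) (c : T -> K) (u : U) (x : T -> V) :
  tens u (\sum_(i <- r) c i *: x i) = \sum_(i <- r) c i *: tens u (x i).
Proof.
elim: r => [|i r IHr]; last by rewrite !big_cons tensDr IHr.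
rewrite !big_nil; have := tensDr u (-1) (0 : V) 0.
by rewrite !scaleN1r oppr0 addr0 addNr.
Qed.

Lemma tensor_sum (t : tensor U V) :
  exists r : seq (U * V), t = \sum_(ab <- r) tens ab.1 ab.2.
Proof.
elim/quotW: t => z.
have pi0 : \pi_(presented (@bilin_rel K U V)) 0 = 0
    :> presented (@bilin_rel K U V).
  by apply: (addrI (\pi 0)); rewrite -Defs.pi_add !addr0.
exists [seq (coeff ab z *: ab.1, ab.2) | ab <- dom z].
rewrite -[in LHS](freeg_sumE z) (big_morph _ (@Defs.pi_add _ _ _) pi0).
rewrite [RHS]big_map.
apply: eq_bigr => -[a b] _ /=.
have -> : << coeff (a, b) z *g (a, b) >> = coeff (a, b) z *: << (a, b) >>
    :> {freeg (U * V)%type / K}.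
  by apply/eqP/freeg_eqP => w; rewrite coeffZ !coeffU mul1r.
rewrite -Defs.pi_scale.
have := tens_suml [:: tt] (fun=> coeff (a, b) z) (fun=> a) b.
by rewrite !big_seq1 => ->.
Qed.

End TensorSums.

(** * The shuffle product is multilinear in the letters *)

Section Multilinear.
Variables (K : fieldType) (Om : nat -> lmodType K).
Local Notation letter := (letter Om).

Definition multilinear (M : lmodType K) (phi : seq letter -> M) :=
  forall l r p c (x y : Om p),
    phi (l ++ mkletter (c *: x + y) :: r)
    = c *: phi (l ++ mkletter x :: r) + phi (l ++ mkletter y :: r).

(** Letting [phi] vary, rather than fixing it to be the class of a word, makes
    this sum stable under removal of first letters: a letter that has come out
    of the shuffle is absorbed in [phi], see [shuffle_sum_cons]. *)
Definition shuffle_sum (M : lmodType K) (phi : seq letter -> M) u v : M :=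
  \sum_(cw <- shuffles u v) cw.1 *: phi cw.2.

Variable M : lmodType K.
Implicit Types phi : seq letter -> M.

Lemma shuffle_sum0l phi v : shuffle_sum phi [::] v = phi v.
Proof. by rewrite /shuffle_sum big_seq1 scale1r. Qed.

Lemma shuffle_sum0r phi u : shuffle_sum phi u [::] = phi u.
Proof. by rewrite /shuffle_sum; case: u => [|a u]; rewrite big_seq1 scale1r. Qed.

Lemma shuffle_sum_cons phi a u b v :
  shuffle_sum phi (a :: u) (b :: v) =
    shuffle_sum (phi \o cons a) u (b :: v)
    + koszul b (a :: u) *: shuffle_sum (phi \o cons b) (a :: u) v.
Proof.
rewrite /shuffle_sum [shuffles _ _]/= big_cat !big_map scaler_sumr.
by congr (_ + _); apply: eq_bigr => cw _; rewrite scalerA.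
Qed.

Lemma shuffle_sum_lin phi phi1 phi2 c u v :
  (forall w, phi w = c *: phi1 w + phi2 w) ->
  shuffle_sum phi u v = c *: shuffle_sum phi1 u v + shuffle_sum phi2 u v.
Proof.
move=> phiE; rewrite /shuffle_sum scaler_sumr -big_split; apply: eq_bigr => cw _.
by rewrite phiE scalerDr !scalerA mulrC.
Qed.

Lemma multilinear_cons phi a : multilinear phi -> multilinear (phi \o cons a).
Proof. by move=> phiL l; exact: (phiL (a :: l)). Qed.

Lemma koszul_letter b l r p (x y : Om p) :
  koszul b (l ++ mkletter x :: r) = koszul b (l ++ mkletter y :: r).
Proof. by rewrite /koszul !big_cat !big_cons. Qed.

Lemma scaler_comb (c k : K) (a b a' b' : M) :
  c *: a + b + k *: (c *: a' + b') = c *: (a + k *: a') + (b + k *: b').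
Proof. by rewrite !scalerDr !scalerA mulrC addrACA. Qed.

(** The letter [c *: x + y] is in the word being shuffled until it comes out
    first; then it is absorbed in [phi], whose multilinearity is used. *)
Lemma shuffle_sum_multil phi v :
  multilinear phi -> multilinear (fun u => shuffle_sum phi u v).
Proof.
move=> phiL l r p c x y.
elim: l v phi phiL => [|a l IHl]; elim=> [|b v IHv] phi phiL;
  rewrite ?shuffle_sum0r ?phiL //.
- rewrite /= !shuffle_sum_cons.
  rewrite (@shuffle_sum_lin _ _ _ c r _ (fun w => phiL [::] w p c x y)).
  rewrite IHv; last exact: multilinear_cons.
  rewrite (koszul_letter b [::] r (c *: x + y) y) (koszul_letter b [::] r x y).
  exact: scaler_comb.
- rewrite /= !shuffle_sum_cons IHl; last exact: multilinear_cons.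
  rewrite -!cat_cons IHv; last exact: multilinear_cons.
  rewrite (koszul_letter b (a :: l) r (c *: x + y) y).
  rewrite (koszul_letter b (a :: l) r x y).
  exact: scaler_comb.
Qed.

Lemma shuffle_sum_multir phi u :
  multilinear phi -> multilinear (shuffle_sum phi u).
Proof.
move=> phiL l r p c x y.
elim: l u phi phiL => [|b l IHl]; elim=> [|a u IHu] phi phiL;
  rewrite ?shuffle_sum0l ?phiL //.
- rewrite /= !shuffle_sum_cons IHu; last exact: multilinear_cons.
  rewrite (@shuffle_sum_lin _ _ _ c (a :: u) r (fun w => phiL [::] w p c x y)).
  exact: scaler_comb.
- rewrite /= !shuffle_sum_cons IHl; last exact: multilinear_cons.
  rewrite IHu; last exact: multilinear_cons.
  exact: scaler_comb.
Qed.

End Multilinear.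

(** * Series in letters of degree one *)

Section BarSums.
Variables (K : fieldType) (Om : nat -> lmodType K).
Variables (I : finType) (A : I -> Om 1%N).
Local Notation letters w := [seq mkletter (A i) | i <- w].

(** A noncommutative power series in the letters [A i], with coefficients
    indexed by words; the structure maps of the bar construction are read off
    on these coefficients. *)
Definition bar_series (c : seq I -> K) : bar Om := fun k =>
  \sum_(t : k.-tuple I) c t *: word k (letters t).

Lemma koszul_degree0 i (u : seq (letter Om)) : koszul (mkletter (A i)) u = 1.
Proof. by rewrite /koszul big1 // => a _; rewrite {2}/bdeg subrr mulr0. Qed.

(** One-forms have degree [0] in the shifted space, so no signs appear. *)
Lemma shuffles_degree0 (u v : seq I) :
  shuffles (letters u) (letters v) = [seq (1, letters w) | w <- interleavings u v].
Proof.
elim: u v => [|a u IHu] //; elim=> [|b v IHv] //.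
rewrite [interleavings _ _]/= map_cat -!map_comp.
rewrite [LHS]/= -/(letters (b :: v)) IHu -map_comp.
congr (_ ++ _).
rewrite -/(shuffles (mkletter (A a) :: letters u) (letters v)).
rewrite -/(letters (a :: u)) IHv -map_comp; apply: eq_map => w /=.
by rewrite koszul_degree0 mulr1.
Qed.

Lemma size_letters k (t : k.-tuple I) : size (letters t) = k.
Proof. by rewrite size_map size_tuple. Qed.

Lemma shuffle_bar_series n p q (c d : seq I -> K) :
  shuffle n (bar_series c p) (bar_series d q)
  = \sum_(u : p.-tuple I) \sum_(v : q.-tuple I)
      \sum_(w <- interleavings u v) (c u * d v) *: word n (letters w).
Proof.
have word_multi : multilinear (@word K Om n) by exact: word_lin.
have inner (u : seq (letter Om)) :
    lin_ext (fun v : q.-tuple _ => shuffle_sum (word n) u v) (bar_series d q)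
    = \sum_(v : q.-tuple I) d v *: shuffle_sum (word n) u (letters v).
  have rel_u := lin_ext_tword (shuffle_sum_multir u word_multi) (n := q).
  rewrite lin_ext_sum //; apply: eq_bigr => v _.
  by rewrite (word_tword [tuple of letters v]) lin_ext_gen.
pose outer u :=
  lin_ext (fun v : q.-tuple _ => shuffle_sum (word n) u v) (bar_series d q).
have outer_multi : multilinear outer.
  move=> l r e k x y; rewrite /outer !inner scaler_sumr -big_split.
  apply: eq_bigr => v _.
  by rewrite (shuffle_sum_multil (letters v) word_multi) scalerDr !scalerA mulrC.
have rel_o := lin_ext_tword outer_multi (n := p).
rewrite [LHS](lin_ext_sum rel_o); apply: eq_bigr => u _.
rewrite (word_tword [tuple of letters u]) lin_ext_gen // /outer inner scaler_sumr.
apply: eq_bigr => v _; rewrite /shuffle_sum shuffles_degree0 big_map !scaler_sumr.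
by apply: eq_bigr => w _; rewrite scale1r scalerA.
Qed.

(** The shuffle product collects the pairs [(u, v)] interleaved by a word, and
    these are the pairs over which the Leibniz rule distributes that word. *)
Lemma bar_mul_series (c d e : seq I -> K) :
  (forall t, e t = \sum_(p <- unshuffles t) c p.1 * d p.2) ->
  bar_series e = bar_mul (bar_series c) (bar_series d).
Proof.
move=> eE; apply: functional_extensionality_dep => k; rewrite /bar_mul.
under [RHS]eq_bigr => i _ do rewrite shuffle_bar_series.
rewrite -(sum_unshuffles k (fun u v w => (c u * d v) *: word k (letters w))).
by apply: eq_bigr => t _; rewrite eE scaler_suml.
Qed.

(** Cutting a word of length [p + q] after [p] letters reindexes these words as
    pairs. *)
Lemma deconc_series (c : seq I -> K) p q :
  deconc (bar_series c) p q
  = \sum_(u : p.-tuple I) \sum_(v : q.-tuple I)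
      c (u ++ v) *: tens (word p (letters u)) (word q (letters v)).
Proof.
have rel_cut := lin_ext_tword (@cut_lin K Om p q) (n := p + q).
rewrite /deconc [LHS](lin_ext_sum rel_cut).
pose F w :=
  c w *: tens (word p (take p (letters w))) (word q (drop p (letters w))).
transitivity (\sum_(t : (p + q).-tuple I) F t).
  apply: eq_bigr => t _.
  by rewrite (word_tword [tuple of letters t]) lin_ext_gen.
rewrite big_tuple_cat; apply: eq_bigr => u _; apply: eq_bigr => v _.
by rewrite /F map_cat take_size_cat ?drop_size_cat // size_letters.
Qed.

Lemma bar_counit_series (c : seq I -> K) : bar_counit (bar_series c) = c [::].
Proof.
have rel0 z : @multilin_rel K Om 0 z ->
    fglift (fun _ : 0.-tuple (letter Om) => 1 : K^o) z = 0.
  case=> l [r [p [e [x [y [s [_ [_ [sE _ _ _]]]]]]]]].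
  by have := size_tuple s; rewrite sE size_cat addnS.
rewrite /bar_counit [LHS](lin_ext_sum rel0).
rewrite (big_tuple0 (fun t => c t *: lin_ext (fun=> 1 : K^o) (word 0 (letters t)))).
by rewrite (word_tword [tuple]) lin_ext_gen // [LHS]mulr1.
Qed.

Lemma bar_series_one (c : seq I -> K) :
  (forall t, c t = (t == [::])%:R) -> bar_series c = bar_one Om.
Proof.
move=> cE; apply: functional_extensionality_dep => -[|k]; rewrite /bar_series.
  by rewrite (big_tuple0 (fun t => c t *: word 0 (letters t))) cE scale1r.
rewrite big1 => [|t _]; first by rewrite /bar_one /word insubF.
by rewrite cE; case: t => -[|a t] //= _; rewrite scale0r.
Qed.

End BarSums.

Section BarTensor.
Variables (K : fieldType) (Om : nat -> lmodType K) (A : lmodType K).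
Variable M : A -> bar Om.
Hypothesis M_lin : forall c f g k, M (c *: f + g) k = c *: M f k + M g k.

Lemma bar_tens2_sum (r : seq (A * A)) p q :
  bar_tens2 M (\sum_(ab <- r) tens ab.1 ab.2) p q
  = \sum_(ab <- r) tens (M ab.1 p) (M ab.2 q).
Proof.
have rel_M z : @bilin_rel K A A z ->
    fglift (fun fg : A * A => tens (M fg.1 p) (M fg.2 q)) z = 0.
  case=> [[c [a [b [v ->]]]]|[v [c [a [b ->]]]]];
    rewrite raddfB raddfB /= fglift_scale !liftU !scale1r /= M_lin.
  - by rewrite tensDl addrAC addrK subrr.
  - by rewrite tensDr addrAC addrK subrr.
rewrite (eq_bigr (fun ab => 1 *: tens ab.1 ab.2)) => [|ab _]; last first.
  by rewrite scale1r.
rewrite [LHS](lin_ext_sum rel_M); apply: eq_bigr => ab _.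
by rewrite scale1r lin_ext_gen.
Qed.

End BarTensor.

(** * Taylor coefficients at the unit *)

Section Coefficients.
Variables (R : realType) (s : ground) (m : nat) (G : matgroup R s m).
Variables (N : nat) (h : 'I_N -> lie G).
Local Notation K := (Defs.scalar R s).
Implicit Types (f g : regfun G) (t u v : seq 'I_N).

Lemma tens_eval_sum (r : seq (regfun G * regfun G)) p q :
  tens_eval (\sum_(ab <- r) tens ab.1 ab.2) p q = \sum_(ab <- r) ab.1 p * ab.2 q.
Proof.
rewrite (eq_bigr (fun ab => 1 *: tens ab.1 ab.2)) => [|ab _]; last first.
  by rewrite scale1r.
rewrite [LHS](lin_ext_sum (tens_eval_rel p q)); apply: eq_bigr => ab _.
by rewrite scale1r -[RHS]tens_eval_tens.
Qed.

Definition lderivs t f : regfun G := foldr (fun i => lderiv (h i)) f t.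

(** The coefficient of [f] at the word [t]: these are the noncommutative Taylor
    coefficients of [f] at the unit. *)
Definition taylor f t : K := lderivs t f (gone G).

Lemma lderivs_lvf t f :
  foldr (fun i => lvf (h i)) (f : G -> K) t = lderivs t f :> (G -> K).
Proof. by elim: t => //= i t ->. Qed.

Lemma lderivs_linear t c f g :
  lderivs t (c *: f + g) = c *: lderivs t f + lderivs t g.
Proof. by elim: t => //= i t ->; exact: lderiv_linear. Qed.

Lemma taylor_linear t c f g : taylor (c *: f + g) t = c * taylor f t + taylor g t.
Proof. by rewrite /taylor lderivs_linear. Qed.

Lemma taylor_sum t (r : seq (regfun G * regfun G)) (c : regfun G -> K) :
  taylor (\sum_(ab <- r) c ab.2 *: ab.1) t
  = \sum_(ab <- r) taylor ab.1 t * c ab.2.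
Proof.
elim: r => [|ab r IHr]; last by rewrite !big_cons taylor_linear IHr mulrC.
rewrite !big_nil; have := taylor_linear t (-1) 0 0.
by rewrite scaleN1r oppr0 addr0 mulN1r addNr.
Qed.

Lemma taylorM f g t :
  taylor (f * g) t = \sum_(p <- unshuffles t) taylor f p.1 * taylor g p.2.
Proof.
rewrite /taylor /lderivs (leibniz_foldr (fun i => @lderivD _ _ _ _ (h i))); last first.
  by move=> i f1 g1; exact: lderivM.
elim: (unshuffles t) => [|p r IHr]; first by rewrite !big_nil.
by rewrite !big_cons -IHr.
Qed.

(** A derivation kills [1], and the last letter of [t] is the first one to act. *)
Lemma taylor1 t : taylor 1 t = (t == [::])%:R.
Proof.
have D1 i : lderiv (h i) 1 = 0.
  have := lderivM (h i) 1 1; rewrite !mulr1 mul1r => E.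
  by apply: (addrI (lderiv (h i) 1)); rewrite addr0 -E.
have lin0 u : lderivs u 0 = 0.
  by have := lderivs_linear u (-1) 0 0; rewrite !scaleN1r oppr0 addr0 addNr.
rewrite /taylor; case: (lastP t) => [|u i] //.
by rewrite /lderivs foldr_rcons D1 [foldr _ _ _]lin0; case: u.
Qed.

(** The operators indexed by [v] act first, and only on the second factor of the
    coproduct by left invariance.  Evaluating the latter at the unit leaves a
    linear combination of the first factors, to which [u] is applied. *)
Lemma taylor_cat f (r : seq (regfun G * regfun G)) :
  (forall p q, f (gmul p q) = \sum_(ab <- r) ab.1 p * ab.2 q) ->
  forall u v, taylor f (u ++ v) = \sum_(ab <- r) taylor ab.1 u * taylor ab.2 v.
Proof.
move=> fr u v.
have split_v p q :
    lderivs v f (gmul p q) = \sum_(ab <- r) ab.1 p * lderivs v ab.2 q.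
  elim: v p q => [|i v IHv] p q; first exact: fr.
  pose r' := [seq (ab.1, lderivs v ab.2) | ab <- r].
  have fr' p' q' : lderivs v f (gmul p' q') = \sum_(ab <- r') ab.1 p' * ab.2 q'.
    by rewrite big_map IHv.
  by rewrite [LHS](lderiv_translate (h i) fr') big_map.
have -> : taylor f (u ++ v) = taylor (lderivs v f) u.
  by rewrite /taylor /lderivs foldr_cat.
rewrite -(taylor_sum u r (fun b => taylor b v)); congr (taylor _ u).
apply/val_inj/funext => p.
rewrite -[in LHS](gmulx1 p) [LHS]split_v.
elim: r {fr split_v} => [|ab r IHr]; first by rewrite !big_nil.
by rewrite !big_cons IHr mulrC.
Qed.

Variables (n : nat) (X : manifold R n) (A : 'I_N -> diffform X s 1).

Lemma MA_bar_series f :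
  MA (G := G) (X := X) h A f = bar_series (Om := @deRham R s n X) A (taylor f).
Proof.
apply: functional_extensionality_dep => k; apply: eq_bigr => t _.
by rewrite lderivs_lvf -(word_tword [tuple of _]).
Qed.

End Coefficients.

(** * The bialgebra homomorphism *)

Theorem proposition1 (R : realType) (s : ground) (m : nat)
    (G : matgroup R s m)
    (G_unitary : unitary G)
    (G_algebraic : algebraic G)
    (G_compact : compact (gset G))
    (G_connected : connected (gset G))
    (G_semisimple : semisimple G)
    (N : nat) (h : 'I_N -> lie G)
    (h_basis : lie_basis h)
    (h_orthonormal : killing_orthonormal h)
    (n : nat) (X : manifold R n)
    (A : 'I_N -> diffform X s 1) :
  is_bialgebra_hom (MA (G := G) (X := X) h A).
Proof.
have MA_linear c f g k :
    MA (X := X) h A (c *: f + g) k = c *: MA h A f k + MA h A g k.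
  rewrite !MA_bar_series /bar_series scaler_sumr -big_split; apply: eq_bigr => t _.
  by rewrite taylor_linear scalerDl scalerA.
split=> [//|||f].
- split=> [|f g]; first by rewrite MA_bar_series; apply/bar_series_one/taylor1.
  by rewrite !MA_bar_series; apply/bar_mul_series/taylorM.
- by move=> f; rewrite MA_bar_series bar_counit_series.
- (* Any expression of the coproduct as a sum of pure tensors will do, since
     [taylor_cat] only uses the function of two variables it represents. *)
  apply: functional_extensionality_dep => p.
  apply: functional_extensionality_dep => q.
  have [r Er] := tensor_sum (reg_coprod f).
  have fr x y : f (gmul x y) = \sum_(ab <- r) ab.1 x * ab.2 y.
    by rewrite -reg_coprodP Er tens_eval_sum.
  rewrite Er bar_tens2_sum // !MA_bar_series deconc_series.
  under [RHS]eq_bigr => ab _ do rewrite !MA_bar_series tens_suml.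
  rewrite [RHS]exchange_big; apply: eq_bigr => u _.
  under [RHS]eq_bigr => ab _ do rewrite tens_sumr scaler_sumr.
  rewrite [RHS]exchange_big; apply: eq_bigr => v _.
  rewrite (taylor_cat h fr) scaler_suml; apply: eq_bigr => ab _.
  by rewrite scalerA.
Qed.
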